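(* Let $\mathcal{C}$ be a triangulated category endowed with a weight structure $w$, and let $\mathcal{A}:\underline{Hw}\to A$ be an additive functor, where $A$ is any abelian category. Choose a weight complex $t(M)=(M^j)$ for each $M\in\mathrm{Obj}\,\mathcal{C}$, and denote by $H(M)=H^{\mathcal{A}}(M)$ the zeroth homology of the complex $(\mathcal{A}(M^j))_j$ (i.e., its homology at $\mathcal{A}(M^0)$). Then $H(-)$ yields a homological functor $\mathcal{C}\to A$ that does not depend on the choices of weight complexes. Moreover, the assignment $\mathcal{A}\mapsto H^{\mathcal{A}}$ is natural in $\mathcal{A}$.
   Context: Weight structures: a pair $(\mathcal{C}_{w\le 0},\mathcal{C}_{w\ge 0})$ of classes of objects such that: (i) both are closed under retracts in $\mathcal{C}$; (ii) $\mathcal{C}_{w\le 0}\subset \mathcal{C}_{w\le 0}[1]$ and $\mathcal{C}_{w\ge 0}[1]\subset \mathcal{C}_{w\ge 0}$; (iii) $\mathcal{C}(X,Y)=0$ for $X\in\mathcal{C}_{w\le 0}$, $Y\in \mathcal{C}_{w\ge 0}[1]$; (iv) every object $M$ fits in a distinguished triangle $LM\to M\to RM\to LM[1]$ with $LM\in\mathcal{C}_{w\le 0}$, $RM\in \mathcal{C}_{w\ge 0}[1]$. Put $\mathcal{C}_{w\le i}=\mathcal{C}_{w\le 0}[i]$, $\mathcal{C}_{w\ge i}=\mathcal{C}_{w\ge 0}[i]$. The heart $\underline{Hw}$ is the full subcategory on $\mathcal{C}_{w\le 0}\cap\mathcal{C}_{w\ge 0}$. Weight complexes: for $M\in\mathrm{Obj}\,\mathcal{C}$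 choose for all $i\in\mathbb{Z}$ distinguished triangles $w_{\le i}M\xrightarrow{h_i}M\to w_{\ge i+1}M\to$ with $w_{\le i}M\in\mathcal{C}_{w\le i}$, $w_{\ge i+1}M\in\mathcal{C}_{w\ge i+1}$. There are unique $j_i:w_{\le i}M\to w_{\le i+1}M$ with $h_{i+1}\circ j_i=h_i$; choose distinguished triangles $w_{\le i-1}M\xrightarrow{j_{i-1}}w_{\le i}M\to M_i\to w_{\le i-1}M[1]$. Put $M^p=M_{-p}[p]$; these objects belong to $\underline{Hw}$. The differential $M^p\to M^{p+1}$ is the shift by $[p]$ of the composition $M_{-p}\to w_{\le -p-1}M[1]\to M_{-p-1}[1]$. Any complex $(M^p)$ obtained this way is called (a choice of) a weight complex of $M$ (complexes are cohomological). Any morphism $g:M\to M'$ in $\mathcal{C}$ extends to a morphism of these data, hence to a morphism of the chosen weight complexes; this is how $H$ is defined on morphisms. *)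

(* Defs.v *)
From mathcomp Require Import all_boot all_algebra.
From mathcomp Require Import boolp.

Set Implicit Arguments.
Unset Strict Implicit.
Unset Printing Implicit Defensive.

Import GRing.Theory.
Local Open Scope ring_scope.

(* Composition is written in the usual order: (g ∘ f) is "f, then g". *)
Record preadditive := Preadditive {
  obj :> Type;
  mor : obj -> obj -> zmodType;
  idm : forall X, mor X X;
  mcomp : forall X Y Z, mor Y Z -> mor X Y -> mor X Z;
  comp1m : forall X Y (f : mor X Y), mcomp (idm Y) f = f;
  compm1 : forall X Y (f : mor X Y), mcomp f (idm X) = f;
  compA : forall X Y Z T (h : mor Z T) (g : mor Y Z) (f : mor X Y),
    mcomp h (mcomp g f) = mcomp (mcomp h g) f;
  compDl : forall X Y Z (g g' : mor Y Z) (f : mor X Y),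
    mcomp (g + g') f = mcomp g f + mcomp g' f;
  compDr : forall X Y Z (g : mor Y Z) (f f' : mor X Y),
    mcomp g (f + f') = mcomp g f + mcomp g f' }.

Arguments mor {p} X Y.
Arguments idm {p} X.
Arguments mcomp {p X Y Z} g f.
Notation "g ∘ f" := (mcomp g f) (at level 40, left associativity).

Definition is_iso (C : preadditive) (X Y : C) (f : mor X Y) : Prop :=
  exists g : mor Y X, g ∘ f = idm X /\ f ∘ g = idm Y.

Definition isomorphic (C : preadditive) (X Y : C) : Prop :=
  exists f : mor X Y, is_iso f.

Definition retract (C : preadditive) (X Y : C) : Prop :=
  exists (i : mor X Y) (r : mor Y X), r ∘ i = idm X.

Definition is_zero (C : preadditive) (Z : C) : Prop :=
  forall X : C, (forall f : mor X Z, f = 0) /\ (forall f : mor Z X, f = 0).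

Definition is_biproduct (C : preadditive) (X Y B : C) : Prop :=
  exists (i1 : mor X B) (i2 : mor Y B) (p1 : mor B X) (p2 : mor B Y),
    [/\ p1 ∘ i1 = idm X, p2 ∘ i2 = idm Y, p1 ∘ i2 = 0, p2 ∘ i1 = 0
      & i1 ∘ p1 + i2 ∘ p2 = idm B].

Record additive_cat := AdditiveCat {
  add_cat :> preadditive;
  zero_ex : exists Z : add_cat, is_zero Z;
  biprod_ex : forall X Y : add_cat, exists B, is_biproduct X Y B }.

Definition full_subcat (C : preadditive) (P : C -> Prop) : preadditive :=
  @Preadditive {X : C | P X} (fun X Y => mor (sval X) (sval Y))
    (fun X => idm (sval X)) (fun X Y Z => @mcomp C (sval X) (sval Y) (sval Z))
    (fun X Y => @comp1m C (sval X) (sval Y))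
    (fun X Y => @compm1 C (sval X) (sval Y))
    (fun X Y Z T => @compA C (sval X) (sval Y) (sval Z) (sval T))
    (fun X Y Z => @compDl C (sval X) (sval Y) (sval Z))
    (fun X Y Z => @compDr C (sval X) (sval Y) (sval Z)).

Definition is_additive_functor (C D : preadditive) (F : C -> D)
    (Fm : forall X Y, mor X Y -> mor (F X) (F Y)) : Prop :=
  [/\ forall X, Fm X X (idm X) = idm (F X),
      forall X Y Z (g : mor Y Z) (f : mor X Y),
        Fm X Z (g ∘ f) = Fm Y Z g ∘ Fm X Y f
    & forall X Y (f g : mor X Y), Fm X Y (f + g) = Fm X Y f + Fm X Y g].

Record additive_functor (C D : preadditive) := AdditiveFunctor {
  fobj :> C -> D;
  fmap : forall X Y, mor X Y -> mor (fobj X) (fobj Y);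
  fmapP : is_additive_functor fmap }.

Arguments fmap {C D} F {X Y} f : rename.

Record nattrans (C D : preadditive) (F G : additive_functor C D) := Nattrans {
  ncomp :> forall X, mor (F X) (G X);
  nnat : forall X Y (f : mor X Y), ncomp Y ∘ fmap F f = fmap G f ∘ ncomp X }.

Section FunctorBasics.
Context {C D : preadditive}.

Lemma fmap1 (F : additive_functor C D) X : fmap F (idm X) = idm (F X).
Proof. by case: (fmapP F). Qed.

Lemma fmapM (F : additive_functor C D) X Y Z (g : mor Y Z) (f : mor X Y) :
  fmap F (g ∘ f) = fmap F g ∘ fmap F f.
Proof. by case: (fmapP F). Qed.

Lemma fmapD (F : additive_functor C D) X Y (f g : mor X Y) :
  fmap F (f + g) = fmap F f + fmap F g.
Proof. by case: (fmapP F). Qed.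

Lemma fmap0 (F : additive_functor C D) X Y : fmap F (0 : mor X Y) = 0.
Proof. by apply: (addrI (fmap F 0)); rewrite -fmapD !addr0. Qed.

Lemma fmapN (F : additive_functor C D) X Y (f : mor X Y) :
  fmap F (- f) = - fmap F f.
Proof. by apply: (addrI (fmap F f)); rewrite -fmapD !subrr fmap0. Qed.

End FunctorBasics.

Lemma idF_subproof (C : preadditive) : @is_additive_functor C C id (fun X Y f => f).
Proof. by split. Qed.

Definition idF (C : preadditive) := AdditiveFunctor (@idF_subproof C).

Lemma compF_subproof (C D E : preadditive) (G : additive_functor D E) (F : additive_functor C D) :
  @is_additive_functor C E (fun X => G (F X)) (fun X Y f => fmap G (fmap F f)).
Proof. by split=> [X|X Y Z g f|X Y f g]; rewrite ?fmap1 ?fmapM ?fmapD. Qed.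

Definition compF (C D E : preadditive) (G : additive_functor D E)
    (F : additive_functor C D) := AdditiveFunctor (compF_subproof G F).

Section Nattrans.
Context {C D : preadditive}.

Lemma nat_id_subproof (F : additive_functor C D) X Y (f : mor X Y) :
  idm (F Y) ∘ fmap F f = fmap F f ∘ idm (F X).
Proof. by rewrite comp1m compm1. Qed.

Definition nat_id (F : additive_functor C D) : nattrans F F :=
  Nattrans (@nat_id_subproof F).

Lemma nat_comp_subproof (F G H : additive_functor C D)
    (b : nattrans G H) (a : nattrans F G) X Y (f : mor X Y) :
  (b Y ∘ a Y) ∘ fmap F f = fmap H f ∘ (b X ∘ a X).
Proof. by rewrite -compA nnat compA nnat compA. Qed.

Definition nat_comp F G H (b : nattrans G H) (a : nattrans F G) :
  nattrans F H := Nattrans (nat_comp_subproof b a).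

End Nattrans.

(* The shift [1] is an additive autoequivalence, with quasi-inverse [-1];
   strict automorphisms are the case where both isomorphisms are identities.
   [dist f g h] means that X -f-> Y -g-> Z -h-> X[1] is distinguished.  The
   fields of the second half are Verdier's axioms TR1 (three fields), TR2,
   TR3, and the octahedral axiom TR4. *)
Record triangulated := Triangulated {
  tri_cat :> additive_cat;
  shift : additive_functor tri_cat tri_cat;
  unshift : additive_functor tri_cat tri_cat;
  shiftK : nattrans (compF unshift shift) (idF tri_cat);
  shiftK_iso : forall X, is_iso (shiftK X);
  unshiftK : nattrans (compF shift unshift) (idF tri_cat);
  unshiftK_iso : forall X, is_iso (unshiftK X);
  dist : forall X Y Z : tri_cat,
    mor X Y -> mor Y Z -> mor Z (shift X) -> Prop;
  dist_iso : forall X Y Z X' Y' Z'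
    (f : mor X Y) (g : mor Y Z) (h : mor Z (shift X))
    (f' : mor X' Y') (g' : mor Y' Z') (h' : mor Z' (shift X'))
    (u : mor X X') (v : mor Y Y') (w : mor Z Z'),
    is_iso u -> is_iso v -> is_iso w ->
    v ∘ f = f' ∘ u -> w ∘ g = g' ∘ v -> fmap shift u ∘ h = h' ∘ w ->
    dist f g h -> dist f' g' h';
  dist_id : forall X Z, is_zero Z ->
    dist (idm X) (0 : mor X Z) (0 : mor Z (shift X));
  dist_cone : forall X Y (f : mor X Y),
    exists Z (g : mor Y Z) (h : mor Z (shift X)), dist f g h;
  dist_rot : forall X Y Z (f : mor X Y) (g : mor Y Z) (h : mor Z (shift X)),
    dist f g h <-> dist g h (- fmap shift f);
  dist_mor : forall X Y Z X' Y' Z'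
    (f : mor X Y) (g : mor Y Z) (h : mor Z (shift X))
    (f' : mor X' Y') (g' : mor Y' Z') (h' : mor Z' (shift X'))
    (u : mor X X') (v : mor Y Y'),
    dist f g h -> dist f' g' h' -> v ∘ f = f' ∘ u ->
    exists w : mor Z Z', w ∘ g = g' ∘ v /\ fmap shift u ∘ h = h' ∘ w;
  dist_oct : forall X Y Z X' Y' Z'
    (f : mor X Y) (f1 : mor Y Z') (f2 : mor Z' (shift X))
    (g : mor Y Z) (g1 : mor Z X') (g2 : mor X' (shift Y))
    (h1 : mor Z Y') (h2 : mor Y' (shift X)),
    dist f f1 f2 -> dist g g1 g2 -> dist (g ∘ f) h1 h2 ->
    exists (u : mor Z' Y') (v : mor Y' X'),
      [/\ dist u v (fmap shift f1 ∘ g2),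
          u ∘ f1 = h1 ∘ g, h2 ∘ u = f2,
          v ∘ h1 = g1 & g2 ∘ v = fmap shift f ∘ h2] }.

Arguments shift {t}.
Arguments unshift {t}.
Arguments shiftK {t}.
Arguments unshiftK {t}.
Arguments dist {t X Y Z} f g h.

Section Shifts.
Context {C : triangulated}.

Fixpoint shiftn (n : nat) : additive_functor C C :=
  if n is m.+1 then compF (shiftn m) shift else idF C.

Fixpoint unshiftn (n : nat) : additive_functor C C :=
  if n is m.+1 then compF (unshiftn m) unshift else idF C.

(* shz p X is X[p] *)
Definition shz (p : int) : additive_functor C C :=
  match p with Posz n => shiftn n | Negz n => unshiftn n.+1 end.

Definition zcast (T : int -> C) (p q : int) (e : p = q) : mor (T p) (T q) :=
  match e in _ = r return mor (T p) (T r) with erefl => idm (T p) end.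

Lemma posz_succ n : Posz n.+1 = Posz n + 1.
Proof. by rewrite -addn1 PoszD. Qed.

Lemma negz_succ n : Negz n = Negz n.+1 + 1.
Proof. by rewrite !NegzE -[in RHS]addn1 PoszD opprD addrNK. Qed.

(* The canonical isomorphism X[1][p] -> X[p+1]. *)
Definition shz_succ (p : int) (X : C) :
    mor (shz p (shift X)) (shz (p + 1) X) :=
  match p return mor (shz p (shift X)) (shz (p + 1) X) with
  | Posz n => zcast (fun q => shz q X) (posz_succ n)
  | Negz 0 => shiftK X
  | Negz n.+1 => zcast (fun q => shz q X) (negz_succ n)
                   ∘ fmap (unshiftn n.+1) (shiftK X)
  end.

End Shifts.

(* The class P[i], closed under isomorphisms as [i] is only an equivalence. *)
Definition shifted (C : triangulated) (P : C -> Prop) (i : int) (X : C) : Prop :=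
  exists2 Y : C, P Y & isomorphic X (shz i Y).

Record weight_structure (C : triangulated) := WeightStructure {
  wle0 : C -> Prop;
  wge0 : C -> Prop;
  wle0_retract : forall X Y, retract X Y -> wle0 Y -> wle0 X;
  wge0_retract : forall X Y, retract X Y -> wge0 Y -> wge0 X;
  wle0_shift : forall X, wle0 X -> shifted wle0 1 X;
  wge0_shift : forall X, shifted wge0 1 X -> wge0 X;
  w_orth : forall X Y (f : mor X Y), wle0 X -> shifted wge0 1 Y -> f = 0;
  w_decomp : forall M : C,
    exists (L R : C) (h : mor L M) (r : mor M R) (d : mor R (shift L)),
      [/\ wle0 L, shifted wge0 1 R & dist h r d] }.

Definition wle (C : triangulated) (w : weight_structure C) i := shifted (wle0 w) i.
Definition wge (C : triangulated) (w : weight_structure C) i := shifted (wge0 w) i.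

Definition heart (C : triangulated) (w : weight_structure C) : preadditive :=
  full_subcat (fun X => wle0 w X /\ wge0 w X).

(* The choices made in the construction of a weight complex of M:
   - triangles  w_{<=i}M -h_i-> M -> w_{>=i+1}M ->  for all i;
   - morphisms  wj i : w_{<=i-1}M -> w_{<=i}M  with  h_i ∘ wj i = h_{i-1},
     so that  wj i  is usually denoted j_{i-1};
   - triangles  w_{<=i-1}M -> w_{<=i}M -> M_i ->  with  M_i = gr i. *)
Record wdata (C : triangulated) (w : weight_structure C) (M : C) := Wdata {
  wleM : int -> C;
  wgeM : int -> C;
  wh : forall i, mor (wleM i) M;
  wr : forall i, mor M (wgeM (i + 1));
  wd : forall i, mor (wgeM (i + 1)) (shift (wleM i));
  wleM_le : forall i, wle w i (wleM i);
  wgeM_ge : forall i, wge w i (wgeM i);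
  wh_dist : forall i, dist (wh i) (wr i) (wd i);
  wj : forall i, mor (wleM (i - 1)) (wleM i);
  wh_wj : forall i, wh i ∘ wj i = wh (i - 1);
  gr : int -> C;
  gr_in : forall i, mor (wleM i) (gr i);
  gr_out : forall i, mor (gr i) (shift (wleM (i - 1)));
  gr_dist : forall i, dist (wj i) (gr_in i) (gr_out i) }.

(* Morphisms between such data extending g : M -> M'. *)
Record wdata_mor (C : triangulated) (w : weight_structure C) (M M' : C)
    (D : wdata w M) (D' : wdata w M') (g : mor M M') := WdataMor {
  mle : forall i, mor (wleM D i) (wleM D' i);
  mge : forall i, mor (wgeM D i) (wgeM D' i);
  mgr : forall i, mor (gr D i) (gr D' i);
  mor_h : forall i, wh D' i ∘ mle i = g ∘ wh D i;
  mor_r : forall i, wr D' i ∘ g = mge (i + 1) ∘ wr D i;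
  mor_d : forall i, wd D' i ∘ mge (i + 1) = fmap shift (mle i) ∘ wd D i;
  mor_j : forall i, wj D' i ∘ mle (i - 1) = mle i ∘ wj D i;
  mor_in : forall i, gr_in D' i ∘ mle i = mgr i ∘ gr_in D i;
  mor_out : forall i, gr_out D' i ∘ mgr i = fmap shift (mle (i - 1)) ∘ gr_out D i }.

(* The proofs up to [gr_heart] and [wdiffK] show that the objects M_{-p}[p]
   lie in the heart and that the differentials compose to zero. *)
Section Basics.
Context {C : preadditive}.

Lemma comp0m (X Y Z : C) (f : mor X Y) : (0 : mor Y Z) ∘ f = 0.
Proof. by apply: (addrI (0 ∘ f)); rewrite -compDl !addr0. Qed.

Lemma compm0 (X Y Z : C) (g : mor Y Z) : g ∘ (0 : mor X Y) = 0.
Proof. by apply: (addrI (g ∘ 0)); rewrite -compDr !addr0. Qed.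

Lemma compNm (X Y Z : C) (g : mor Y Z) (f : mor X Y) : (- g) ∘ f = - (g ∘ f).
Proof. by apply: (addrI (g ∘ f)); rewrite -compDl !subrr comp0m. Qed.

Lemma compmN (X Y Z : C) (g : mor Y Z) (f : mor X Y) : g ∘ (- f) = - (g ∘ f).
Proof. by apply: (addrI (g ∘ f)); rewrite -compDr !subrr compm0. Qed.

Lemma iso_refl (X : C) : isomorphic X X.
Proof. by exists (idm X), (idm X); rewrite comp1m. Qed.

Lemma iso_sym (X Y : C) : isomorphic X Y -> isomorphic Y X.
Proof. by move=> [f [g [gf fg]]]; exists g, f. Qed.

Lemma iso_trans (X Y Z : C) :
  isomorphic X Y -> isomorphic Y Z -> isomorphic X Z.
Proof.
move=> [f [g [gf fg]]] [h [k [kh hk]]]; exists (h ∘ f), (g ∘ k).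
by split; rewrite compA; [rewrite -(compA g) kh | rewrite -(compA h) fg];
  rewrite compm1.
Qed.

Lemma iso_retract (X Y : C) : isomorphic X Y -> retract X Y.
Proof. by move=> [f [g [gf _]]]; exists f, g. Qed.

Lemma retract_trans (X Y Z : C) : retract X Y -> retract Y Z -> retract X Z.
Proof.
move=> [i [r ri]] [i' [r' ri']]; exists (i' ∘ i), (r ∘ r').
by rewrite compA -(compA r) ri' compm1.
Qed.

End Basics.

Lemma iso_fmap (C D : preadditive) (F : additive_functor C D) (X Y : C) :
  isomorphic X Y -> isomorphic (F X) (F Y).
Proof.
move=> [f [g [gf fg]]]; exists (fmap F f), (fmap F g).
by rewrite -!fmapM gf fg !fmap1.
Qed.

Lemma retract_fmap (C D : preadditive) (F : additive_functor C D) (X Y : C) :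
  retract X Y -> retract (F X) (F Y).
Proof.
by move=> [f [g gf]]; exists (fmap F f), (fmap F g); rewrite -!fmapM gf !fmap1.
Qed.

Section TriangulatedFacts.
Context {C : triangulated}.

Lemma unshift_faithful (X Y : C) (f g : mor X Y) :
  fmap unshift f = fmap unshift g -> f = g.
Proof.
move=> e; have [r [rK Kr]] := @unshiftK_iso C X.
have e' : f ∘ unshiftK X = g ∘ unshiftK X by rewrite -!(nnat unshiftK) /= e.
by rewrite -[f]compm1 -Kr compA e' -compA Kr compm1.
Qed.

Lemma shift_faithful (X Y : C) (f g : mor X Y) :
  fmap shift f = fmap shift g -> f = g.
Proof.
move=> e; have [r [rK Kr]] := @shiftK_iso C X.
have e' : f ∘ shiftK X = g ∘ shiftK X by rewrite -!(nnat shiftK) /= e.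
by rewrite -[f]compm1 -Kr compA e' -compA Kr compm1.
Qed.

Lemma shift_full (X Y : C) (f : mor (shift X) (shift Y)) :
  exists g : mor X Y, fmap shift g = f.
Proof.
have [r [rK Kr]] := @shiftK_iso C X; have [s [sK Ks]] := @shiftK_iso C Y.
exists (shiftK Y ∘ fmap unshift f ∘ r); apply: unshift_faithful.
set g := _ ∘ r; have : g ∘ shiftK X = shiftK Y ∘ fmap unshift f.
  by rewrite /g -compA rK compm1.
rewrite -(nnat shiftK) /= => /(congr1 (mcomp s)).
by rewrite !compA sK !comp1m.
Qed.

Lemma unshift_full (X Y : C) (f : mor (unshift X) (unshift Y)) :
  exists g : mor X Y, fmap unshift g = f.
Proof.
have [r [rK Kr]] := @unshiftK_iso C X; have [s [sK Ks]] := @unshiftK_iso C Y.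
exists (unshiftK Y ∘ fmap shift f ∘ r); apply: shift_faithful.
set g := _ ∘ r; have : g ∘ unshiftK X = unshiftK Y ∘ fmap shift f.
  by rewrite /g -compA rK compm1.
rewrite -(nnat unshiftK) /= => /(congr1 (mcomp s)).
by rewrite !compA sK !comp1m.
Qed.

Lemma iso_shiftK (X : C) : isomorphic (unshift (shift X)) X.
Proof. by exists (shiftK X); apply: shiftK_iso. Qed.

Lemma iso_unshiftK (X : C) : isomorphic (shift (unshift X)) X.
Proof. by exists (unshiftK X); apply: unshiftK_iso. Qed.

Lemma shz_faithful p (X Y : C) (f g : mor X Y) :
  fmap (shz p) f = fmap (shz p) g -> f = g.
Proof.
have sh n : forall (X Y : C) (f g : mor X Y),
    fmap (shiftn n) f = fmap (shiftn n) g -> f = g.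
  by elim: n => [|n IH] //= U V a b /IH /shift_faithful.
have us n : forall (X Y : C) (f g : mor X Y),
    fmap (unshiftn n) f = fmap (unshiftn n) g -> f = g.
  by elim: n => [|n IH] //= U V a b /IH /unshift_faithful.
by case: p => n; [apply: sh | apply: us].
Qed.

Lemma shz_full p (X Y : C) (f : mor (shz p X) (shz p Y)) :
  exists g : mor X Y, fmap (shz p) g = f.
Proof.
have sh n : forall (X Y : C) (f : mor (shiftn n X) (shiftn n Y)),
    exists g, fmap (shiftn n) g = f.
  elim: n => [|n IH] /= U V a; first by exists a.
  by have [b <-] := IH _ _ a; have [c <-] := shift_full b; exists c.
have us n : forall (X Y : C) (f : mor (unshiftn n X) (unshiftn n Y)),
    exists g, fmap (unshiftn n) g = f.
  elim: n => [|n IH] /= U V a; first by exists a.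
  by have [b <-] := IH _ _ a; have [c <-] := unshift_full b; exists c.
by case: p f => n f; [apply: sh | apply: us].
Qed.

Lemma shiftnS n (X : C) : shiftn n (shift X) = shift (shiftn n X) :> C.
Proof. by elim: n X => [|n IH] //= X; rewrite IH. Qed.

Lemma unshiftnS n (X : C) : unshiftn n (unshift X) = unshift (unshiftn n X) :> C.
Proof. by elim: n X => [|n IH] //= X; rewrite IH. Qed.

Lemma iso_shiftnK n (X : C) : isomorphic (unshiftn n (shiftn n X)) X.
Proof.
elim: n X => [|n IH] X /=; first exact: iso_refl.
rewrite shiftnS; apply: iso_trans (IH X).
exact: iso_fmap (iso_shiftK _).
Qed.

Lemma iso_unshiftnK n (X : C) : isomorphic (shiftn n (unshiftn n X)) X.
Proof.
elim: n X => [|n IH] X /=; first exact: iso_refl.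
rewrite unshiftnS; apply: iso_trans (IH X).
exact: iso_fmap (iso_unshiftK _).
Qed.

Lemma iso_shzN p (X : C) : isomorphic (shz p (shz (- p) X)) X.
Proof.
case: p => [[|n]|n]; [exact: iso_refl | exact: iso_unshiftnK | exact: iso_shiftnK].
Qed.

Lemma zcast_iso (T : int -> C) p q (e : p = q) : is_iso (zcast T e).
Proof. by case: q / e; exists (idm _); rewrite comp1m. Qed.

Lemma iso_succ p (X : C) : isomorphic (shz p (shift X)) (shz (p + 1) X).
Proof.
case: p => [n|[|n]]; first by rewrite -posz_succ; apply: iso_refl.
  exact: iso_shiftK.
by rewrite -negz_succ; apply: iso_fmap (iso_shiftK X).
Qed.

Lemma iso_shift_shz p (X : C) : isomorphic (shift (shz p X)) (shz (p + 1) X).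
Proof.
apply: iso_trans (iso_succ p X); case: p => n /=.
  by rewrite shiftnS; apply: iso_refl.
rewrite unshiftnS; apply: iso_trans (iso_unshiftK _) _.
apply: iso_trans (iso_fmap (unshiftn n) (iso_sym (iso_shiftK X))).
exact: iso_refl.
Qed.

Lemma zero_shift (Z : C) : is_zero Z -> is_zero (shift Z).
Proof.
move=> Z0; have idZ : idm (shift Z) = 0.
  by rewrite -fmap1 ((Z0 Z).1 (idm Z)) fmap0.
by move=> X; split=> f; [rewrite -[f]comp1m idZ comp0m|rewrite -[f]compm1 idZ compm0].
Qed.

Lemma dist_comp0 (X Y Z : C) (f : mor X Y) (g : mor Y Z) h :
  dist f g h -> g ∘ f = 0.
Proof.
move=> d; have [O O0] := zero_ex C.
have e : f ∘ idm X = f ∘ idm X by [].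
have [w [<- _]] := dist_mor (dist_id X O0) d e.
by rewrite compm0.
Qed.

Lemma dist_lift (X Y Z : C) (f : mor X Y) (g : mor Y Z) h W (a : mor W Y) :
  dist f g h -> g ∘ a = 0 -> exists b, a = f ∘ b.
Proof.
move=> d ga; have [O O0] := zero_ex C.
have d0 := (dist_rot _ _ _).1 (dist_id W O0).
have d' := (dist_rot _ _ _).1 d.
have e : (0 : mor O Z) ∘ 0 = g ∘ a by rewrite comp0m ga.
have [w [_]] := dist_mor d0 d' e.
have [b <-] := shift_full w; rewrite fmap1 compmN compm1 compNm -fmapM.
by move=> /oppr_inj /shift_faithful ->; exists b.
Qed.

Lemma dist_ext (X Y Z : C) (f : mor X Y) (g : mor Y Z) h W (a : mor Y W) :
  dist f g h -> a ∘ f = 0 -> exists b, a = b ∘ g.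
Proof.
move=> d af; have [O O0] := zero_ex C.
have d0 : dist (0 : mor O W) (idm W) (0 : mor W (shift O)).
  apply/dist_rot; rewrite fmap0 oppr0; apply: dist_id; exact: zero_shift.
have e : a ∘ f = 0 ∘ (0 : mor X O) by rewrite comp0m.
have [b [bg _]] := dist_mor d d0 e.
by exists b; rewrite bg comp1m.
Qed.

Section Weights.
Context (w : weight_structure C).

Lemma wle0_char (X : C) :
  (forall Y (f : mor X Y), wge w 1 Y -> f = 0) -> wle0 w X.
Proof.
move=> X0; have [L [R [h [r [d [Lw Rw tri]]]]]] := w_decomp w X.
have [s hs] : exists s, idm X = h ∘ s.
  by apply: dist_lift tri _; rewrite compm1; apply: X0.
by apply: wle0_retract Lw; exists s, h.
Qed.

Lemma wge1_char (Y : C) :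
  (forall X (f : mor X Y), wle0 w X -> f = 0) -> wge w 1 Y.
Proof.
move=> Y0; have [L [R [h [r [d [Lw [Z Zw RZ] tri]]]]]] := w_decomp w Y.
have [s rs] : exists s, idm Y = s ∘ r.
  by apply: dist_ext tri _; rewrite comp1m; apply: Y0.
exists (unshift Y); last exact: iso_sym (iso_unshiftK _).
apply: wge0_retract Zw; have YZ : retract Y (shift Z).
  by apply: retract_trans (iso_retract RZ); exists r, s.
exact: retract_trans (retract_fmap unshift YZ) (iso_retract (iso_shiftK Z)).
Qed.

Lemma shifted_iso (P : C -> Prop) i (X Y : C) :
  isomorphic X Y -> shifted P i Y -> shifted P i X.
Proof. by move=> XY [Z PZ YZ]; exists Z => //; apply: iso_trans YZ. Qed.

Lemma shifted_shift (P : C -> Prop) i (X : C) :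
  shifted P i X -> shifted P (i + 1) (shift X).
Proof.
move=> [Z PZ XZ]; exists Z => //.
exact: iso_trans (iso_fmap shift XZ) (iso_shift_shz i Z).
Qed.

Lemma w_orthz i (X Y : C) (f : mor X Y) :
  wle w i X -> wge w (i + 1) Y -> f = 0.
Proof.
move=> [X0 wX [a [a' [a'a aa']]]] [Y0 wY YY0].
have [b [b' [b'b bb']]] := iso_trans YY0 (iso_sym (iso_succ i Y0)).
have [g gE] := shz_full (b ∘ f ∘ a').
have g0 : g = 0 by apply: w_orth wX _; exists Y0 => //; apply: iso_refl.
rewrite g0 fmap0 in gE.
by rewrite -[f]compm1 -a'a -[f]comp1m -b'b compA -!(compA b') -gE comp0m compm0.
Qed.

Lemma wle_char i (X : C) :
  (forall Y (f : mor X Y), wge w (i + 1) Y -> f = 0) -> wle w i X.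
Proof.
move=> X0; have XX := iso_sym (iso_shzN i X).
exists (shz (- i) X) => //; apply: wle0_char => Y f [Y0 wY YY0].
apply: (@shz_faithful i); rewrite fmap0; have [a [a' [a'a aa']]] := XX.
suff e : fmap (shz i) f ∘ a = 0 by rewrite -[LHS]compm1 -aa' compA e comp0m.
apply: X0; exists Y0 => //.
exact: iso_trans (iso_fmap (shz i) YY0) (iso_succ i Y0).
Qed.

Lemma wge_char i (Y : C) :
  (forall X (f : mor X Y), wle w (i - 1) X -> f = 0) -> wge w i Y.
Proof.
move=> Y0; have YY := iso_shzN (i - 1) Y.
have [Z wZ YZ] : wge w 1 (shz (- (i - 1)) Y).
  apply: wge1_char => X f wX; apply: (@shz_faithful (i - 1)); rewrite fmap0.
  have [a [a' [a'a aa']]] := YY.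
  suff e : a ∘ fmap (shz (i - 1)) f = 0 by rewrite -[LHS]comp1m -a'a -compA e compm0.
  by apply: Y0; exists X => //; apply: iso_refl.
have ZZ := iso_trans (iso_fmap (shz (i - 1)) YZ) (iso_succ (i - 1) Z).
by exists Z => //; rewrite subrK in ZZ; apply: iso_trans (iso_sym YY) ZZ.
Qed.

Lemma shifted_unshift (P : C -> Prop) p (X : C) :
  (forall X Y, retract X Y -> P Y -> P X) ->
  shifted P (- p) X -> P (shz p X).
Proof.
move=> Pr [Y PY XY]; apply: Pr PY; apply: iso_retract.
exact: iso_trans (iso_fmap _ XY) (iso_shzN p Y).
Qed.

Context {M : C} (D : wdata w M).

Lemma gr_le i : wle w i (gr D i).
Proof.
have rot := (dist_rot _ _ _).1 (gr_dist D i).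
apply: wle_char => Y f wY.
have [b ->] : exists b, f = b ∘ gr_out D i.
  by apply: dist_ext rot _; apply: w_orthz wY; apply: wleM_le.
suff -> : b = 0 by rewrite comp0m.
apply: w_orthz wY; rewrite -{1}[i](subrK 1).
by apply: shifted_shift; apply: wleM_le.
Qed.

Lemma gr_ge i : wge w i (gr D i).
Proof.
have tri := wh_dist D (i - 1); rewrite -wh_wj in tri.
have [u [v [d _ _ _ _]]] := dist_oct (gr_dist D i) (wh_dist D i) tri.
apply: wge_char => X f wX.
have d' := (dist_rot _ _ _).1 ((dist_rot _ _ _).1 d).
have uf : u ∘ f = 0 by apply: w_orthz wX _; apply: wgeM_ge.
have [b fb] : exists b, fmap shift f = (fmap shift (gr_in D i) ∘ wd D i) ∘ b.
  by apply: dist_lift d' _; rewrite compNm -fmapM uf fmap0 oppr0.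
apply: shift_faithful; rewrite fmap0 fb.
suff -> : b = 0 by rewrite compm0.
apply: (@w_orthz i); last exact: wgeM_ge.
by rewrite -[i](subrK 1); apply: shifted_shift.
Qed.

Lemma gr_heart p : wle0 w (shz p (gr D (- p))) /\ wge0 w (shz p (gr D (- p))).
Proof.
split; first by apply: shifted_unshift (gr_le _); apply: wle0_retract.
by apply: shifted_unshift (gr_ge _); apply: wge0_retract.
Qed.

End Weights.

Lemma zcast_shz (X Y : C) (f : mor X Y) p q (e : p = q) :
  fmap (shz q) f ∘ zcast (fun i => shz i X) e
  = zcast (fun i => shz i Y) e ∘ fmap (shz p) f.
Proof. by case: q / e; rewrite comp1m compm1. Qed.

Lemma zcast_nat (T U : int -> C) r (f : forall i, mor (T i) (U i)) p q (e : p = q) :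
  fmap (shz r) (f q) ∘ zcast (fun i => shz r (T i)) e
  = zcast (fun i => shz r (U i)) e ∘ fmap (shz r) (f p).
Proof. by case: q / e; rewrite comp1m compm1. Qed.

Lemma shz_succ_nat p (X Y : C) (f : mor X Y) :
  shz_succ p Y ∘ fmap (shz p) (fmap shift f)
  = fmap (shz (p + 1)) f ∘ shz_succ p X.
Proof.
case: p => [n|[|n]].
- exact: esym (zcast_shz f (posz_succ n)).
- exact: nnat shiftK _ _ _.
- rewrite /shz_succ compA zcast_shz -!compA; congr (_ ∘ _).
  have e := nnat shiftK f.
  exact: etrans (esym (fmapM (unshiftn n.+1) _ _))
           (etrans (congr1 _ e) (fmapM (unshiftn n.+1) _ _)).
Qed.

End TriangulatedFacts.

(* Cohomological cochain complexes. *)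
Record complex (C : preadditive) := Complex {
  cobj :> int -> C;
  cd : forall p, mor (cobj p) (cobj (p + 1));
  cdK : forall p, cd (p + 1) ∘ cd p = 0 }.

Record complex_mor (C : preadditive) (K L : complex C) := ComplexMor {
  cmor :> forall p, mor (K p) (L p);
  cmorP : forall p, cmor (p + 1) ∘ cd K p = cd L p ∘ cmor p }.

Section WeightComplex.
Context {C : triangulated} {w : weight_structure C}.

Definition wobj (M : C) (D : wdata w M) (p : int) : heart w :=
  exist _ (shz p (gr D (- p))) (gr_heart D p).

(* M_{-p}[p] -> M_{-p-1}[1][p] -> M_{-p-1}[p+1] = M_{-(p+1)}[p+1]; the first
   map is the [p]-shift of M_{-p} -> w_{<=-p-1}M[1] -> M_{-p-1}[1], and the
   other two are the canonical identifications. *)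
Definition wdiff (M : C) (D : wdata w M) (p : int) :
    mor (wobj D p) (wobj D (p + 1)) :=
  zcast (fun i => shz (p + 1) (gr D i)) (esym (opprD p 1))
    ∘ shz_succ p (gr D (- p - 1))
    ∘ fmap (shz p) (fmap shift (gr_in D (- p - 1)) ∘ gr_out D (- p)).

Lemma wdiffK (M : C) (D : wdata w M) (p : int) : wdiff D (p + 1) ∘ wdiff D p = 0.
Proof.
rewrite /wdiff /= [fmap (shz (p + 1)) _]fmapM; set q := p + 1.
rewrite -!compA [fmap (shz q) (gr_out D _) ∘ _]compA.
rewrite (zcast_nat _ (gr_out D)) -!compA.
rewrite [fmap (shz q) _ ∘ (shz_succ _ _ ∘ _)]compA -shz_succ_nat -!compA.
rewrite -[fmap (shz p) _ ∘ fmap (shz p) _]fmapM [_ ∘ (_ ∘ gr_out D (- p))]compA.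
rewrite -fmapM.
have e := (dist_rot _ _ _).1 (gr_dist D (- p - 1)).
by rewrite (dist_comp0 e) fmap0 comp0m fmap0 !compm0.
Qed.

Definition weight_complex (M : C) (D : wdata w M) : complex (heart w) :=
  Complex (wdiffK D).

Definition wmor (M M' : C) (D : wdata w M) (D' : wdata w M') (g : mor M M')
    (phi : wdata_mor D D' g) (p : int) : mor (wobj D p) (wobj D' p) :=
  fmap (shz p) (mgr phi (- p)).

Lemma wmorP (M M' : C) (D : wdata w M) (D' : wdata w M') (g : mor M M')
    (phi : wdata_mor D D' g) (p : int) :
  wmor phi (p + 1) ∘ wdiff D p = wdiff D' p ∘ wmor phi p.
Proof.
rewrite /wmor /wdiff /= !compA (zcast_nat _ (mgr phi)).
rewrite -!compA; congr (_ ∘ _).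
rewrite compA -shz_succ_nat -compA -!fmapM; congr (_ ∘ fmap _ _).
by rewrite -[RHS]compA mor_out !compA -!fmapM mor_in.
Qed.

Definition weight_complex_mor (M M' : C) (D : wdata w M) (D' : wdata w M')
    (g : mor M M') (phi : wdata_mor D D' g) :
  complex_mor (weight_complex D) (weight_complex D') :=
  @ComplexMor _ (weight_complex D) (weight_complex D') (wmor phi) (wmorP phi).

End WeightComplex.

Definition is_kernel (C : preadditive) (X Y : C) (f : mor X Y)
    (K : C) (k : mor K X) : Prop :=
  f ∘ k = 0 /\
  forall (T : C) (a : mor T X), f ∘ a = 0 -> exists! b : mor T K, k ∘ b = a.

Definition is_cokernel (C : preadditive) (X Y : C) (f : mor X Y)
    (Q : C) (q : mor Y Q) : Prop :=
  q ∘ f = 0 /\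
  forall (T : C) (a : mor Y T), a ∘ f = 0 -> exists! b : mor Q T, b ∘ q = a.

Definition mono (C : preadditive) (X Y : C) (f : mor X Y) : Prop :=
  forall (T : C) (a b : mor T X), f ∘ a = f ∘ b -> a = b.

Definition epi (C : preadditive) (X Y : C) (f : mor X Y) : Prop :=
  forall (T : C) (a b : mor Y T), a ∘ f = b ∘ f -> a = b.

Record abelian := Abelian {
  ab_cat :> additive_cat;
  kernel_ex : forall (X Y : ab_cat) (f : mor X Y),
    exists s : {K : ab_cat & mor K X}, is_kernel f (projT2 s);
  cokernel_ex : forall (X Y : ab_cat) (f : mor X Y),
    exists s : {Q : ab_cat & mor Y Q}, is_cokernel f (projT2 s);
  mono_normal : forall (X Y : ab_cat) (f : mor X Y), mono f ->
    exists (Z : ab_cat) (g : mor Y Z), is_kernel g f;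
  epi_normal : forall (X Y : ab_cat) (f : mor X Y), epi f ->
    exists (Z : ab_cat) (g : mor Z X), is_cokernel g f }.

Section Homology.
Context {A : abelian}.

Definition ker_obj (X Y : A) (f : mor X Y) : A := projT1 (sval (cid (kernel_ex f))).
Definition ker_mor (X Y : A) (f : mor X Y) : mor (ker_obj f) X :=
  projT2 (sval (cid (kernel_ex f))).
Definition coker_obj (X Y : A) (f : mor X Y) : A :=
  projT1 (sval (cid (cokernel_ex f))).
Definition coker_mor (X Y : A) (f : mor X Y) : mor Y (coker_obj f) :=
  projT2 (sval (cid (cokernel_ex f))).

Lemma ker_morP (X Y : A) (f : mor X Y) : is_kernel f (ker_mor f).
Proof. exact: svalP (cid (kernel_ex f)). Qed.

Lemma coker_morP (X Y : A) (f : mor X Y) : is_cokernel f (coker_mor f).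
Proof. exact: svalP (cid (cokernel_ex f)). Qed.

Lemma ker_lift_ex (X Y T : A) (f : mor X Y) (a : mor T X) :
  f ∘ a = 0 -> exists b, ker_mor f ∘ b = a.
Proof. by move=> fa; have [b [? _]] := (ker_morP f).2 _ _ fa; exists b. Qed.

Lemma coker_desc_ex (X Y T : A) (f : mor X Y) (a : mor Y T) :
  a ∘ f = 0 -> exists b, b ∘ coker_mor f = a.
Proof. by move=> fa; have [b [? _]] := (coker_morP f).2 _ _ fa; exists b. Qed.

Definition ker_lift (X Y T : A) (f : mor X Y) (a : mor T X) (fa : f ∘ a = 0) :
  mor T (ker_obj f) := sval (cid (ker_lift_ex fa)).

Definition coker_desc (X Y T : A) (f : mor X Y) (a : mor Y T) (af : a ∘ f = 0) :
  mor (coker_obj f) T := sval (cid (coker_desc_ex af)).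

Lemma ker_liftK (X Y T : A) (f : mor X Y) (a : mor T X) (fa : f ∘ a = 0) :
  ker_mor f ∘ ker_lift fa = a.
Proof. by rewrite /ker_lift; case: (cid _). Qed.

Lemma coker_descK (X Y T : A) (f : mor X Y) (a : mor Y T) (af : a ∘ f = 0) :
  coker_desc af ∘ coker_mor f = a.
Proof. by rewrite /coker_desc; case: (cid _). Qed.

Lemma ker_mor_mono (X Y : A) (f : mor X Y) : mono (ker_mor f).
Proof.
move=> T a b e; have [fk uk] := ker_morP f.
have fkb : f ∘ (ker_mor f ∘ b) = 0 by rewrite compA fk comp0m.
have [c [_ cU]] := uk _ _ fkb.
by rewrite -(cU b) // -(cU a).
Qed.

(* X -f-> Y -g-> Z is exact at Y: the image ker(coker f) of f is a kernel of g. *)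
Definition exact_at (X Y Z : A) (f : mor X Y) (g : mor Y Z) : Prop :=
  is_kernel g (ker_mor (coker_mor f)).

(* The differentials around degree 0, using that -1 + 1 computes to 0. *)
Definition d_in (K : complex A) : mor (K (- 1)) (K 0) := cd K (- 1).
Definition d_out (K : complex A) : mor (K 0) (K 1) := cd K 0.

Lemma d_out_in (K : complex A) : d_out K ∘ d_in K = 0.
Proof. exact: (cdK K (- 1)). Qed.

(* The map K^{-1} -> ker (K^0 -> K^1), whose cokernel is the homology. *)
Definition bound (K : complex A) : mor (K (- 1)) (ker_obj (d_out K)) :=
  ker_lift (d_out_in K).

Definition H0 (K : complex A) : A := coker_obj (bound K).

Section H0map.
Context {K L : complex A} (f : complex_mor K L).

Lemma cycles_map_subproof : d_out L ∘ (f 0 ∘ ker_mor (d_out K)) = 0.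
Proof.
have e : f 1 ∘ d_out K = d_out L ∘ f 0 := cmorP f 0.
by rewrite compA -e -compA (ker_morP _).1 compm0.
Qed.

Definition cycles_map : mor (ker_obj (d_out K)) (ker_obj (d_out L)) :=
  ker_lift cycles_map_subproof.

Lemma H0_map_subproof : (coker_mor (bound L) ∘ cycles_map) ∘ bound K = 0.
Proof.
have e : f 0 ∘ d_in K = d_in L ∘ f (- 1) := cmorP f (- 1).
have -> : coker_mor (bound L) ∘ cycles_map ∘ bound K
          = coker_mor (bound L) ∘ (bound L ∘ f (- 1)).
  rewrite -compA; congr (_ ∘ _); apply: ker_mor_mono.
  by rewrite !compA !ker_liftK -compA ker_liftK e.
by rewrite compA (coker_morP _).1 comp0m.
Qed.

Definition H0_map : mor (H0 K) (H0 L) := coker_desc H0_map_subproof.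

End H0map.
End Homology.

Section MapComplex.
Context {C D : preadditive}.

Lemma map_complex_subproof (F : additive_functor C D) (K : complex C) (p : int) :
  fmap F (cd K (p + 1)) ∘ fmap F (cd K p) = 0.
Proof. by rewrite -fmapM cdK fmap0. Qed.

Definition map_complex (F : additive_functor C D) (K : complex C) : complex D :=
  @Complex D (fun p => F (K p)) _ (map_complex_subproof F K).

Lemma map_complex_mor_subproof (F : additive_functor C D) (K L : complex C)
    (f : complex_mor K L) (p : int) :
  fmap F (f (p + 1)) ∘ fmap F (cd K p) = fmap F (cd L p) ∘ fmap F (f p).
Proof. by rewrite -!fmapM cmorP. Qed.

Definition map_complex_mor (F : additive_functor C D) (K L : complex C)
    (f : complex_mor K L) : complex_mor (map_complex F K) (map_complex F L) :=
  @ComplexMor D (map_complex F K) (map_complex F L) (fun p => fmap F (f p))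
    (map_complex_mor_subproof F f).

Definition map_complex_nat (F G : additive_functor C D) (a : nattrans F G)
    (K : complex C) : complex_mor (map_complex F K) (map_complex G K) :=
  @ComplexMor D (map_complex F K) (map_complex G K) (fun p => a (K p))
    (fun p => nnat a (cd K p)).

End MapComplex.

Definition homological (C : triangulated) (A : abelian) (H : C -> A)
    (Hm : forall X Y, mor X Y -> mor (H X) (H Y)) : Prop :=
  is_additive_functor Hm /\
  forall X Y Z (f : mor X Y) (g : mor Y Z) (h : mor Z (shift X)),
    dist f g h -> exact_at (Hm X Y f) (Hm Y Z g).

Section HF.
Context {C : triangulated} {w : weight_structure C} {A : abelian}.

(* The zeroth homology of (F(M^j))_j, for the weight complex given by D. *)
Definition HF (F : additive_functor (heart w) A) (M : C) (D : wdata w M) : A :=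
  H0 (map_complex F (weight_complex D)).

Definition HF_mor (F : additive_functor (heart w) A) (M M' : C)
    (D : wdata w M) (D' : wdata w M') (g : mor M M') (phi : wdata_mor D D' g) :
    mor (HF F D) (HF F D') :=
  H0_map (map_complex_mor F (weight_complex_mor phi)).

Definition HF_nat (F F' : additive_functor (heart w) A) (a : nattrans F F')
    (M : C) (D : wdata w M) : mor (HF F D) (HF F' D) :=
  H0_map (map_complex_nat a (weight_complex D)).

End HF.

(* Main.v *)
From mathcomp Require Import all_boot all_algebra.
From mathcomp Require Import boolp.
Require Import Defs.

Set Implicit Arguments.
Unset Strict Implicit.
Unset Printing Implicit Defensive.

Import GRing.Theory.
Local Open Scope ring_scope.

(** The idea is that a morphism [g : M -> M'] determines the morphism of weight
    complexes up to weak homotopy, and that for suitable choices of data a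
    distinguished triangle becomes a sequence of weight complexes that is split
    exact in the degrees around zero.

    Well-definedness. Extensions of [g] to the chosen data exist by
    orthogonality ([wdata_mor_ex]). The difference of two of them extends zero,
    and in degree zero any extension of zero has the form [d s + t d]
    ([mgr_null]); additive functors preserve this form, and such a map vanishes
    on homology ([H0_map_null]). So [H] is well defined on morphisms; as data
    morphisms can be composed and added, [H] is an additive functor, and the
    extensions of [idm M] between two choices of data for [M] are mutually
    inverse on [H]. Naturality in the functor on the heart is seen termwise.

    Exactness. By rotation it suffices to treat [H(Y) -> H(Z) -> H(X[1])] for a
    distinguished triangle [X -> Y -> Z -> X[1]], and the data of [Z] may be
    chosen at will. The cone of the map [w_{<=i-1} X -> w_{<=i} Y] serves as
    [w_{<=i} Z] ([cone_trunc_ex]), and then [w_{<=i-1} Z -> w_{<=i} Z] can be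
    chosen, by the 3x3 lemma [dist3x3], so that [Z_i] is an extension of
    [X_{i-1}[1]] by [Y_i]; it splits because [X_{i-1} -> Y_i] is zero
    ([cone_step_split_ex]). These choices are made downwards, each step determining
    the truncation below it, and only for the three values of [i] around zero,
    which are all that the zeroth homology involves ([cone_tower_ex]). Finally a short sequence of complexes which is split in
    these degrees is exact on homology ([H0_exact]). *)

(** * Distinguished triangles *)

Section Triangles.
Context {C : triangulated}.

Lemma is_iso_id (D : preadditive) (X : D) : is_iso (idm X).
Proof. by exists (idm X); rewrite comp1m. Qed.

Lemma is_iso_opp (D : preadditive) (X : D) : is_iso (- idm X).
Proof. by exists (- idm X); rewrite compNm comp1m opprK. Qed.

Lemma dist_shift (X Y Z : C) (f : mor X Y) (g : mor Y Z) (h : mor Z (shift X)) :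
  dist f g h -> dist (fmap shift f) (fmap shift g) (- fmap shift h).
Proof.
move=> /dist_rot/dist_rot/dist_rot d.
apply: (dist_iso (u := - idm _) (v := idm _) (w := - idm _)) d.
- exact: is_iso_opp.
- exact: is_iso_id.
- exact: is_iso_opp.
- by rewrite comp1m compmN compm1.
- by rewrite compNm comp1m opprK compm1.
- by rewrite fmapN fmap1 !compNm !compmN comp1m compm1 opprK.
Qed.

(** A map killed by [f] comes, after a shift, from the cone of [f]. *)
Lemma dist_lift_shift (X Y Z : C) (f : mor X Y) (g : mor Y Z) h W
    (a : mor W X) :
  dist f g h -> f ∘ a = 0 -> exists b, fmap shift a = h ∘ b.
Proof.
move=> /dist_rot/dist_rot d fa.
by apply: dist_lift d _; rewrite compNm -fmapM fa fmap0 oppr0.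
Qed.

Lemma dist_split (X Y Z : C) (f : mor X Y) (g : mor Y Z) :
  dist f g 0 ->
  exists (r : mor Y X) (s : mor Z Y),
    [/\ r ∘ f = idm X, g ∘ s = idm Z & f ∘ r + s ∘ g = idm Y].
Proof.
move=> d.
have [s gs] : exists s, idm Z = g ∘ s.
  by apply: dist_lift ((dist_rot _ _ _).1 d) _; rewrite comp0m.
have [r fr] : exists r, idm Y - s ∘ g = f ∘ r.
  apply: dist_lift d _.
  by rewrite compDr compmN compm1 compA -gs comp1m subrr.
exists r, s; split=> //; last by rewrite -fr subrK.
have [b] : exists b, fmap shift (r ∘ f - idm X) = (0 : mor Z (shift X)) ∘ b.
  apply: dist_lift_shift (d) _.
  rewrite compDr compmN compm1 compA -fr compDl compNm comp1m -compA.
  by rewrite (dist_comp0 d) compm0 subr0 subrr.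
rewrite comp0m -(fmap0 shift) => /shift_faithful e.
by rewrite -[LHS](subrK (idm X)) e add0r.
Qed.

(** The unshifting of [g[1]] is [g], read through [X[1][-1] = X]. *)
Lemma shiftK_conj (X : C) :
  exists K : mor X (unshift (shift X)), forall (Y : C) (g : mor X Y),
    @mcomp C _ (unshift (shift Y)) _ (shiftK Y)
      (fmap unshift (fmap shift g) ∘ K) = g.
Proof.
have [K [_ Ks]] := @shiftK_iso C X; exists K => Y g.
have e := nnat shiftK g; rewrite /= in e.
by rewrite compA [X in X ∘ K]e -compA Ks compm1.
Qed.

(** The 3x3 lemma for a commutative square [f u = v f'] with prescribed cones
    of its four sides: the cones of [f'] and of [f] are related by a map [j]
    whose cone [G] is an extension of [U[1]] by [V]. The last square
    anticommutes, whence the sign. *)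
Lemma dist3x3 (P' P U Q' Q V K' K : C)
    (u : mor P' P) (ui : mor P U) (uo : mor U (shift P'))
    (v : mor Q' Q) (vi : mor Q V) (vo : mor V (shift Q'))
    (f' : mor P' Q') (a' : mor Q' K') (b' : mor K' (shift P'))
    (f : mor P Q) (a : mor Q K) (b : mor K (shift P)) :
  dist u ui uo -> dist v vi vo -> dist f' a' b' -> dist f a b ->
  f ∘ u = v ∘ f' ->
  exists (j : mor K' K) (G : C) (gi : mor K G) (go : mor G (shift K'))
      (m : mor V G) (n : mor G (shift U)) (e : mor U V),
  [/\ dist j gi go, dist m n (- fmap shift e),
      j ∘ a' = a ∘ v /\ b ∘ j = fmap shift u ∘ b',
      m ∘ vi = gi ∘ a /\ go ∘ m = fmap shift a' ∘ vo
    & n ∘ gi = fmap shift ui ∘ b /\ (- fmap shift uo) ∘ n = fmap shift b' ∘ go].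
Proof.
move=> du dv df' df fu.
have [S [s1 [s2 ds]]] := dist_cone (f ∘ u).
have ds' := ds; rewrite fu in ds'.
have [u1 [v1 [d1 u1a s2u1 v1s vov]]] := dist_oct df' dv ds'.
have [u2 [v2 [d2 u2u s2u2 v2s bv]]] := dist_oct du df ds.
have [G [gi [go dj]]] := dist_cone (v2 ∘ u1).
have [m [n [dmn mv gom ngi un]]] := dist_oct d1 ((dist_rot _ _ _).1 d2) dj.
exists (v2 ∘ u1), G, gi, go, m, n, (v1 ∘ u2); split=> //.
- by rewrite fmapM -compmN.
- split; first by rewrite -compA u1a compA v2s.
  by rewrite compA bv -compA s2u1.
- by rewrite -v1s compA mv -compA v2s.
- split=> //; rewrite -s2u1 -s2u2 !fmapM -[RHS]compA -un.
  by rewrite !compNm compmN compA.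
Qed.

End Triangles.

(** * Weight truncations *)

Section Truncations.
Context {C : triangulated} (w : weight_structure C).

Lemma wle_succ i (X : C) : wle w i X -> wle w (i + 1) X.
Proof.
move=> [Y /wle0_shift [Z wZ YZ] XY]; exists Z => //.
exact: iso_trans (iso_trans XY (iso_fmap (shz i) YZ)) (iso_succ i Z).
Qed.

Lemma wge_pred i (X : C) : wge w (i + 1) X -> wge w i X.
Proof.
move=> wX; apply: wge_char => Y f wY.
by apply: (@w_orthz C w i) => //; rewrite -[i](subrK 1); apply: wle_succ.
Qed.

Lemma wge_ext i (X Y Z : C) (f : mor X Y) (g : mor Y Z) h :
  dist f g h -> wge w i X -> wge w i Z -> wge w i Y.
Proof.
move=> d wX wZ; apply: wge_char => T t wT.
have [s ->] : exists s, t = f ∘ s.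
  by apply: dist_lift d _; apply: w_orthz wT _; rewrite subrK.
by rewrite (@w_orthz C w (i - 1) _ _ s) ?compm0 ?subrK.
Qed.

Lemma wle_ext i (X Y Z : C) (f : mor X Y) (g : mor Y Z) h :
  dist f g h -> wle w i X -> wle w i Z -> wle w i Y.
Proof.
move=> d wX wZ; apply: wle_char => T t wT.
have [s ->] : exists s, t = s ∘ g by apply: dist_ext d _; apply: w_orthz wX wT.
by rewrite (w_orthz s wZ wT) comp0m.
Qed.

(** [h : K -> M] is a choice of [w_{<=i} M -> M]. *)
Definition wtrunc i (K M : C) (h : mor K M) : Prop :=
  wle w i K /\
  exists (R : C) (r : mor M R) (d : mor R (shift K)),
    wge w (i + 1) R /\ dist h r d.

Lemma wtrunc_wh (M : C) (D : wdata w M) i : wtrunc i (wh D i).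
Proof.
split; first exact: wleM_le.
exists (wgeM D (i + 1)), (wr D i), (wd D i).
by split; [apply: wgeM_ge | apply: wh_dist].
Qed.

Lemma wtrunc_shift i (K M : C) (h : mor K M) :
  wtrunc i h -> wtrunc (i + 1) (fmap shift h).
Proof.
move=> [wK [R [r [d [wR dh]]]]]; split; first exact: shifted_shift.
exists (shift R), (fmap shift r), (- fmap shift d).
by split; [apply: shifted_shift | apply: dist_shift].
Qed.

Lemma wtrunc_lift i (K M T : C) (h : mor K M) (t : mor T M) :
  wtrunc i h -> wle w i T -> exists l, h ∘ l = t.
Proof.
move=> [_ [R [r [d [wR dh]]]]] wT.
have [l ->] : exists l, t = h ∘ l by apply: dist_lift dh _; apply: w_orthz wT wR.
by exists l.
Qed.

(** Maps into [w_{<=i} M] from objects of weight at most [i - 1] are determined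
    by their composites to [M]. *)
Lemma wtrunc_inj i (K M T : C) (h : mor K M) (x y : mor T K) :
  wtrunc i h -> wle w (i - 1) T -> h ∘ x = h ∘ y -> x = y.
Proof.
move=> [_ [R [r [d [wR dh]]]]] wT hxy.
have [b] : exists b, fmap shift (x - y) = d ∘ b.
  by apply: dist_lift_shift dh _; rewrite compDr compmN hxy subrr.
rewrite (@w_orthz C w i _ _ b) //; last first.
  by rewrite -[i](subrK 1); apply: shifted_shift.
rewrite compm0 -(fmap0 shift) => /shift_faithful e.
by rewrite -[LHS](subrK y) e add0r.
Qed.

(** A truncation at [i] composed with a map whose cone has weight at least [i]
    is a truncation at [i - 1], by the octahedral axiom. *)
Lemma wtrunc_comp i (K' K G M : C) (j : mor K' K) (h : mor K M) gi go :
  wle w (i - 1) K' -> @dist C K' K G j gi go -> wge w i G ->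
  wtrunc i h -> wtrunc (i - 1) (h ∘ j).
Proof.
move=> wK' dj wG [wK [R [r [d [wR dh]]]]]; split=> //; rewrite subrK.
have [R' [r' [d' dhj]]] := dist_cone (h ∘ j).
have [u [v [duv _ _ _ _]]] := dist_oct dj dh dhj.
exists R', r', d'; split=> //.
by apply: wge_ext duv wG (wge_pred wR).
Qed.

End Truncations.

(** * Weight data *)

Section Data.
Context {C : triangulated} {w : weight_structure C}.

Lemma zcast_id (T : int -> C) p (e : p = p) : zcast T e = idm (T p).
Proof. by rewrite (Prop_irrelevance e erefl). Qed.

(** The cones of the [k i], reindexed so that the cone of [k i] is the
    [i + 1]-st object. *)
Lemma wtrunc_cones (M : C) (K : int -> C) (k : forall i, mor (K i) M) :
  (forall i, wtrunc w i (k i)) ->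
  exists s : {R : int -> C & ((forall i, mor M (R (i + 1)%R)) *
                              (forall i, mor (R (i + 1)%R) (shift (K i))))%type},
    (forall i, wge w i (projT1 s i)) /\
    (forall i, dist (k i) ((projT2 s).1 i) ((projT2 s).2 i)).
Proof.
move=> kt.
have cone i : exists s : {R : C & (mor M R * mor R (shift (K i)))%type},
    wge w (i + 1) (projT1 s) /\ dist (k i) (projT2 s).1 (projT2 s).2.
  by have [_ [R [r [d [wR dk]]]]] := kt i; exists (existT _ R (r, d)).
pose c i := sval (cid (cone i)).
pose R i := projT1 (c i); pose r i : mor M (R i) := (projT2 (c i)).1.
pose d i : mor (R i) (shift (K i)) := (projT2 (c i)).2.
have wR (i : int) : wge w (i + 1) (R i) := (svalP (cid (cone i))).1.
have dR i : dist (k i) (r i) (d i) := (svalP (cid (cone i))).2.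
pose R' (i : int) := R (i - 1); have e (i : int) : i = i + 1 - 1 by rewrite addrK.
exists (existT _ R' (fun i => zcast R (e i) ∘ r i,
                     fun i => d i ∘ zcast R (esym (e i)))) => /=.
split=> i; first by have := wR (i - 1); rewrite subrK.
rewrite /R'; case: _ / (e i); rewrite /= comp1m compm1; exact: dR.
Qed.

(** Weight data can be built from its parts other than the objects
    [w_{>=i} M], which are recovered as cones. *)
Definition wdata_of (M : C) (K : int -> C) (k : forall i, mor (K i) M)
    (kt : forall i, wtrunc w i (k i))
    (j : forall i, mor (K (i - 1)) (K i))
    (kj : forall i, k i ∘ j i = k (i - 1))
    (G : int -> C) (gi : forall i, mor (K i) (G i))
    (go : forall i, mor (G i) (shift (K (i - 1))))
    (dj : forall i, dist (j i) (gi i) (go i)) : wdata w M :=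
  let s := cid (wtrunc_cones kt) in
  Wdata (fun i => (kt i).1) (svalP s).1 (svalP s).2 kj dj.

(** Compatible components on the [w_{<=i}] and the [M_i] extend to a morphism of
    weight data; commutation with the [wj] is automatic. *)
Lemma wdata_mor_of (M M' : C) (D : wdata w M) (D' : wdata w M') (g : mor M M')
    (l : forall i, mor (wleM D i) (wleM D' i))
    (m : forall i, mor (gr D i) (gr D' i)) :
  (forall i, wh D' i ∘ l i = g ∘ wh D i) ->
  (forall i, gr_in D' i ∘ l i = m i ∘ gr_in D i) ->
  (forall i, gr_out D' i ∘ m i = fmap shift (l (i - 1)) ∘ gr_out D i) ->
  exists phi : wdata_mor D D' g, forall i, mgr phi i = m i.
Proof.
move=> hl hi ho.
have jl i : wj D' i ∘ l (i - 1) = l i ∘ wj D i.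
  apply: wtrunc_inj (wtrunc_wh D' i) (wleM_le D (i - 1)) _.
  by rewrite !compA wh_wj !hl -compA wh_wj.
(* the component at [i] comes from the triangles of index [i - 1] *)
have ex (i : int) : exists n : mor (wgeM D i) (wgeM D' i),
    forall (i0 : int) (e : i0 + 1 = i),
    [/\ zcast (wgeM D') e ∘ wr D' i0 ∘ g = n ∘ zcast (wgeM D) e ∘ wr D i0 &
     wd D' i0 ∘ zcast (wgeM D') (esym e) ∘ n ∘ zcast (wgeM D) e
       = fmap shift (l i0) ∘ wd D i0].
  rewrite -(subrK 1 i); move: (i - 1) => i1.
  have [n [nr nd]] := dist_mor (wh_dist D i1) (wh_dist D' i1) (esym (hl i1)).
  exists n => i0 e; have e' : i1 = i0 by apply/esym/(addIr 1).
  case: _ / e' e => e.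
  by rewrite !zcast_id !compm1 comp1m.
pose n i := sval (cid (ex i)).
have nP (i : int) := svalP (cid (ex (i + 1))) i erefl.
have nr i : wr D' i ∘ g = n (i + 1) ∘ wr D i.
  by have [] := nP i; rewrite !zcast_id comp1m compm1.
have nd i : wd D' i ∘ n (i + 1) = fmap shift (l i) ∘ wd D i.
  by have [_] := nP i; rewrite !zcast_id !compm1.
by exists (WdataMor hl nr nd jl hi ho).
Qed.

Lemma wdata_mor_ex (M M' : C) (D : wdata w M) (D' : wdata w M') (g : mor M M') :
  inhabited (wdata_mor D D' g).
Proof.
have lex i : exists l, wh D' i ∘ l = g ∘ wh D i.
  by apply: wtrunc_lift (wtrunc_wh D' i) (wleM_le D i).
pose l i := sval (cid (lex i)).
have hl i : wh D' i ∘ l i = g ∘ wh D i := svalP (cid (lex i)).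
have jl i : l i ∘ wj D i = wj D' i ∘ l (i - 1).
  apply: wtrunc_inj (wtrunc_wh D' i) (wleM_le D (i - 1)) _.
  by rewrite !compA wh_wj !hl -compA wh_wj.
have mex i := dist_mor (gr_dist D i) (gr_dist D' i) (jl i).
pose m i := sval (cid (mex i)); have mP i := svalP (cid (mex i)).
have [phi _] := wdata_mor_of hl (fun i => esym (mP i).1) (fun i => esym (mP i).2).
exact: inhabits phi.
Qed.

Section Operations.
Context {M M' : C} {D : wdata w M} {D' : wdata w M'}.

Lemma wdata_mor_id : exists phi : wdata_mor D D (idm M),
  forall i, mgr phi i = idm (gr D i).
Proof.
by apply: (wdata_mor_of (l := fun i => idm _) (m := fun i => idm _)) => i;
  rewrite ?fmap1 comp1m compm1.
Qed.

Lemma wdata_mor_comp (M'' : C) (D'' : wdata w M'') g f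
    (psi : wdata_mor D' D'' g) (phi : wdata_mor D D' f) :
  exists chi : wdata_mor D D'' (g ∘ f),
    forall i, mgr chi i = mgr psi i ∘ mgr phi i.
Proof.
apply: (wdata_mor_of (l := fun i => mle psi i ∘ mle phi i)
  (m := fun i => mgr psi i ∘ mgr phi i)) => i.
- by rewrite compA mor_h -!compA mor_h.
- by rewrite compA mor_in -!compA mor_in.
- by rewrite compA mor_out fmapM -!compA mor_out.
Qed.

Lemma wdata_mor_add f g (phi : wdata_mor D D' f) (psi : wdata_mor D D' g) :
  exists chi : wdata_mor D D' (f + g),
    forall i, mgr chi i = mgr phi i + mgr psi i.
Proof.
apply: (wdata_mor_of (l := fun i => mle phi i + mle psi i)
  (m := fun i => mgr phi i + mgr psi i)) => i;
  rewrite compDr ?fmapD compDl.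
- by rewrite !mor_h.
- by rewrite !mor_in.
- by rewrite !mor_out.
Qed.

Lemma wdata_mor_opp f (phi : wdata_mor D D' f) :
  exists chi : wdata_mor D D' (- f), forall i, mgr chi i = - mgr phi i.
Proof.
apply: (wdata_mor_of (l := fun i => - mle phi i)
  (m := fun i => - mgr phi i)) => i;
  rewrite compmN ?fmapN ?compNm.
- by rewrite mor_h.
- by rewrite mor_in.
- by rewrite mor_out.
Qed.

End Operations.

Lemma wdiffN1 (M : C) (D : wdata w M) :
  wdiff D (- 1) =
  shiftK (gr D 0) ∘ fmap unshift (fmap shift (gr_in D 0) ∘ gr_out D 1).
Proof. by rewrite /wdiff zcast_id comp1m. Qed.

Lemma wdiff0 (M : C) (D : wdata w M) :
  wdiff D 0 = fmap shift (gr_in D (- 1)) ∘ gr_out D 0.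
Proof. by rewrite /wdiff zcast_id comp1m [shz_succ _ _]zcast_id comp1m. Qed.

(** A morphism of weight data over zero is null-homotopic in degree zero, in
    the weak sense that [s] and [t] need not be components of one homotopy.
    Indeed, by orthogonality, [mle phi 0] factors as
    [w_{<=0} M -> M_0 -> M'_1[-1] -> w_{<=0} M'], which gives [s]; what is left
    of [mgr phi 0] vanishes on [w_{<=0} M], and factors by orthogonality as
    [M_0 -> w_{<=-1} M[1] -> M_{-1}[1] -> M'_0], which gives [t]. *)
Lemma mgr_null (M M' : C) (D : wdata w M) (D' : wdata w M')
    (phi : wdata_mor D D' 0) :
  exists (s : mor (wobj D 0) (wobj D' (- 1))) (t : mor (wobj D 1) (wobj D' 0)),
    wmor phi 0 = wdiff D' (- 1) ∘ s + t ∘ wdiff D 0.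
Proof.
have lj : wj D' 1 ∘ mle phi 0 = 0.
  apply: wtrunc_inj (wtrunc_wh D' 1) (wleM_le D 0) _.
  by rewrite compA wh_wj mor_h compm0 comp0m.
have [y ly] := dist_lift_shift (gr_dist D' 1) lj.
have [y' yy'] : exists y', y = y' ∘ fmap shift (gr_in D 0).
  apply: dist_ext (dist_shift (gr_dist D 0)) _.
  apply: (@w_orthz C w 0); last exact: gr_ge.
  exact: (shifted_shift (wleM_le D (- 1))).
have [K KE] := shiftK_conj (gr D 0).
pose s := fmap unshift y' ∘ K.
have [x xy] := shift_full (gr_out D' 1 ∘ y').
have lx : mle phi 0 = x ∘ gr_in D 0.
  by apply: shift_faithful; rewrite ly yy' compA fmapM xy.
have [z mz] : exists z, mgr phi 0 - gr_in D' 0 ∘ x = z ∘ gr_out D 0.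
  apply: dist_ext ((dist_rot _ _ _).1 (gr_dist D 0)) _.
  by rewrite compDl compNm -mor_in -compA -lx subrr.
have [t zt] : exists t, z = t ∘ fmap shift (gr_in D (- 1)).
  apply: dist_ext (dist_shift (gr_dist D (- 1))) _.
  apply: (@w_orthz C w (- 1)); last exact: gr_ge.
  exact: (shifted_shift (wleM_le D (- 2))).
have sx : shiftK (gr D' 0) ∘ fmap unshift (fmap shift (gr_in D' 0) ∘ gr_out D' 1)
    ∘ (fmap unshift y' ∘ K) = gr_in D' 0 ∘ x.
  rewrite -compA [X in shiftK _ ∘ X]compA -(fmapM unshift) -[_ ∘ y']compA -xy -fmapM.
  exact: KE.
have tx : z ∘ gr_out D 0 = t ∘ (fmap shift (gr_in D (- 1)) ∘ gr_out D 0).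
  by rewrite zt -compA.
exists s, t; rewrite wdiff0 wdiffN1.
rewrite -[LHS](subrK (gr_in D' 0 ∘ x)) [LHS]addrC.
exact: congr2 (esym sx) (etrans mz tx).
Qed.

End Data.

(** * Homology classes in abelian categories *)

Section Abelian.
Context {A : abelian}.

Lemma epi0 (X Y : A) (f : mor X Y) :
  (forall T (a : mor Y T), a ∘ f = 0 -> a = 0) -> epi f.
Proof.
move=> f0 T a b ab; rewrite -[a](subrK b) (f0 _ (a - b)) ?add0r //.
by rewrite compDl compNm ab subrr.
Qed.

Lemma coker_mor_epi (X Y : A) (f : mor X Y) : epi (coker_mor f).
Proof.
move=> T a b e; have [qf uq] := coker_morP f.
have bqf : b ∘ coker_mor f ∘ f = 0 by rewrite -compA qf compm0.
by have [c [_ cU]] := uq _ _ bqf; rewrite -(cU b) // -(cU a).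
Qed.

(** Epimorphisms are stable under pullback. *)
Lemma epi_pullback (E B T : A) (p : mor E B) (a : mor T B) :
  epi p -> exists (T' : A) (q : mor T' T) (e : mor T' E),
    epi q /\ p ∘ e = a ∘ q.
Proof.
move=> ep; have [S [i1 [i2 [p1 [p2 [p1i1 p2i2 p1i2 p2i1 ip]]]]]] := biprod_ex E T.
pose d := p ∘ p1 - a ∘ p2.
have di1 : d ∘ i1 = p.
  by rewrite compDl compNm -!compA p1i1 p2i1 compm1 compm0 subr0.
have ed : epi d by move=> U x y /(congr1 (mcomp^~ i1)); rewrite -!compA di1 => /ep.
have [Z [g [dg ug]]] := epi_normal ed.
exists (ker_obj d), (p2 ∘ ker_mor d), (p1 ∘ ker_mor d); split; last first.
  apply: subr0_eq; rewrite !compA -compNm -compDl; exact: (ker_morP d).1.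
apply: epi0 => U u; rewrite compA => uk.
(* [u p2] kills the kernel of the cokernel map [d], hence factors through it *)
have [v [vd _]] : exists! v, v ∘ d = u ∘ p2.
  by apply: ug; have [b <-] := ker_lift_ex dg; rewrite compA uk comp0m.
have v0 : v = 0.
  by apply: ep; rewrite comp0m -di1 compA vd -compA p2i1 compm0.
by rewrite -[u]compm1 -p2i2 compA -vd v0 !comp0m.
Qed.

(** A map killed by the cokernel of [k] factors through [k] after passing to
    an epimorphic cover of its source. *)
Lemma coker0_cover (X Y T : A) (k : mor X Y) (z : mor T Y) :
  coker_mor k ∘ z = 0 -> exists (T' : A) (q : mor T' T) (c : mor T' X),
    epi q /\ k ∘ c = z ∘ q.
Proof.
move=> kz; pose m := ker_mor (coker_mor k).
have [e me] := ker_lift_ex (coker_morP k).1; rewrite -/m in me.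
have [z' mz'] := ker_lift_ex kz; rewrite -/m in mz'.
suff ee : epi e.
  have [T' [q [c [eq ec]]]] := epi_pullback z' ee.
  by exists T', q, c; rewrite -me -compA ec compA mz'.
apply: epi0 => U u ue; pose n := ker_mor u.
have [e' ne'] := ker_lift_ex ue; rewrite -/n in ne'.
have mn : mono (m ∘ n).
  by move=> V a b; rewrite -!compA => /ker_mor_mono/ker_mor_mono.
have [V [v [vmn uv]]] := mono_normal mn.
have [v' vv'] : exists v', v' ∘ coker_mor k = v.
  by apply: coker_desc_ex; rewrite -me -ne' !compA -(compA v) vmn comp0m.
have [s [ms _]] : exists! s, m ∘ n ∘ s = m.
  by apply: uv; rewrite -vv' -compA (ker_morP _).1 compm0.
have ns : n ∘ s = idm _ by apply: ker_mor_mono; rewrite compA ms compm1.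
by rewrite -[u]compm1 -ns compA (ker_morP u).1 comp0m.
Qed.

(** [hclass K x a]: the generalized element [x] of [K 0] is a cycle, and [a]
    is its homology class. *)
Definition hclass (K : complex A) (T : A) (x : mor T (K 0)) (a : mor T (H0 K)) :
    Prop :=
  exists z : mor T (ker_obj (d_out K)),
    ker_mor (d_out K) ∘ z = x /\ coker_mor (bound K) ∘ z = a.

Section Classes.
Context {K : complex A}.

Lemma hclass_cycle T (x : mor T (K 0)) a : hclass x a -> d_out K ∘ x = 0.
Proof. by move=> [z [<- _]]; rewrite compA (ker_morP _).1 comp0m. Qed.

Lemma hclass_ex T (x : mor T (K 0)) :
  d_out K ∘ x = 0 -> exists a, hclass x a.
Proof. by move=> /ker_lift_ex [z zx]; exists (coker_mor (bound K) ∘ z), z. Qed.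

Lemma hclass_bound T (x y : mor T (K 0)) a b (c : mor T (K (- 1))) :
  hclass x a -> hclass y b -> x = y + d_in K ∘ c -> a = b.
Proof.
move=> [z [<- <-]] [z' [<- <-]] e.
have -> : z = z' + bound K ∘ c.
  by apply: ker_mor_mono; rewrite e compDr compA ker_liftK.
by rewrite compDr compA (coker_morP _).1 comp0m addr0.
Qed.

Lemma hclass_uniq T (x : mor T (K 0)) a b : hclass x a -> hclass x b -> a = b.
Proof. by move=> xa xb; apply: (hclass_bound (c := 0)) xa xb _; rewrite compm0 addr0. Qed.

Lemma hclass_comp T S (x : mor T (K 0)) a (t : mor S T) :
  hclass x a -> hclass (x ∘ t) (a ∘ t).
Proof. by move=> [z [<- <-]]; exists (z ∘ t); rewrite !compA. Qed.

Lemma hclassD T (x y : mor T (K 0)) a b :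
  hclass x a -> hclass y b -> hclass (x + y) (a + b).
Proof. by move=> [z [<- <-]] [z' [<- <-]]; exists (z + z'); rewrite !compDr. Qed.

Lemma hclass_cover T (a : mor T (H0 K)) :
  exists (T' : A) (q : mor T' T) (x : mor T' (K 0)),
    epi q /\ hclass x (a ∘ q).
Proof.
have [T' [q [z [eq qz]]]] := epi_pullback a (@coker_mor_epi _ _ (bound K)).
by exists T', q, (ker_mor (d_out K) ∘ z); split=> //; exists z.
Qed.

Lemma hclass0_cover T (x : mor T (K 0)) :
  hclass x 0 -> exists (T' : A) (q : mor T' T) (c : mor T' (K (- 1))),
    epi q /\ d_in K ∘ c = x ∘ q.
Proof.
move=> [z [<- /coker0_cover [T' [q [c [eq kc]]]]]].
by exists T', q, c; split=> //; rewrite -compA -kc compA ker_liftK.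
Qed.

Lemma H0_ext (B : A) (u v : mor (H0 K) B) :
  (forall T (x : mor T (K 0)) a, hclass x a -> u ∘ a = v ∘ a) -> u = v.
Proof.
move=> uv; apply: coker_mor_epi; apply: uv (ker_mor _) _ _.
by exists (idm _); rewrite !compm1.
Qed.

End Classes.

Lemma H0_map_class (K L : complex A) (f : complex_mor K L) T (x : mor T (K 0)) a :
  hclass x a -> hclass (f 0 ∘ x) (H0_map f ∘ a).
Proof.
move=> [z [<- <-]]; exists (cycles_map f ∘ z).
by rewrite !compA coker_descK ker_liftK.
Qed.

Lemma H0_map_id (K : complex A) (f : complex_mor K K) :
  f 0 = idm (K 0) -> H0_map f = idm (H0 K).
Proof.
move=> f0; apply: H0_ext => T x a xa; have := H0_map_class f xa.
by rewrite f0 !comp1m => xfa; apply: hclass_uniq xfa xa.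
Qed.

Lemma H0_map_comp (K L N : complex A) (g : complex_mor L N) (f : complex_mor K L)
    (h : complex_mor K N) :
  h 0 = g 0 ∘ f 0 -> H0_map h = H0_map g ∘ H0_map f.
Proof.
move=> e; apply: H0_ext => T x a xa; rewrite -compA.
have := H0_map_class g (H0_map_class f xa); rewrite compA -e.
exact: hclass_uniq (H0_map_class h xa).
Qed.

Lemma H0_map_square (K L L' N : complex A) (f : complex_mor K L)
    (g : complex_mor L N) (f' : complex_mor K L') (g' : complex_mor L' N) :
  g 0 ∘ f 0 = g' 0 ∘ f' 0 -> H0_map g ∘ H0_map f = H0_map g' ∘ H0_map f'.
Proof.
move=> e; apply: H0_ext => T x a xa; rewrite -!compA.
have := H0_map_class g' (H0_map_class f' xa); rewrite compA -e -compA.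
exact: hclass_uniq (H0_map_class g (H0_map_class f xa)).
Qed.

Lemma H0_mapD (K L : complex A) (f g h : complex_mor K L) :
  h 0 = f 0 + g 0 -> H0_map h = H0_map f + H0_map g.
Proof.
move=> e; apply: H0_ext => T x a xa; rewrite compDl.
have := hclassD (H0_map_class f xa) (H0_map_class g xa); rewrite -compDl -e.
exact: hclass_uniq (H0_map_class h xa).
Qed.

Lemma H0_map_null (K L : complex A) (f : complex_mor K L)
    (s : mor (K 0) (L (- 1))) (t : mor (K 1) (L 0)) :
  f 0 = d_in L ∘ s + t ∘ d_out K -> H0_map f = 0.
Proof.
move=> e; apply: H0_ext => T x a xa; rewrite comp0m.
have z0 : @hclass L T 0 0 by exists 0; rewrite !compm0.
apply: (hclass_bound (c := s ∘ x)) (H0_map_class f xa) z0 _.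
rewrite e compDl -!(compA t) (hclass_cycle xa) compm0 addr0 add0r.
by rewrite compA.
Qed.

Lemma exact_atP (X Y Z : A) (f : mor X Y) (g : mor Y Z) :
  exact_at f g <->
  g ∘ f = 0 /\ forall T (a : mor T Y), g ∘ a = 0 -> coker_mor f ∘ a = 0.
Proof.
split=> [[gk uk] | [gf cf]].
  split=> [|T a /uk [b [<- _]]]; last by rewrite compA (ker_morP _).1 comp0m.
  have [e <-] := ker_lift_ex (coker_morP f).1.
  by rewrite compA gk comp0m.
split; first by have [t <-] := coker_desc_ex gf; rewrite -compA (ker_morP _).1 compm0.
move=> T a /cf/ker_lift_ex [b mb]; exists b; split=> // b' mb'.
by apply: ker_mor_mono; rewrite mb.
Qed.

Lemma exact_at_iso (X Y Z Y' Z' : A) (f : mor X Y) (g : mor Y Z)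
    (u : mor Y Y') (u' : mor Y' Y) (v : mor Z Z') (v' : mor Z' Z) :
  u' ∘ u = idm Y -> u ∘ u' = idm Y' -> v' ∘ v = idm Z ->
  exact_at f g -> exact_at (u ∘ f) (v ∘ g ∘ u').
Proof.
move=> u'u uu' v'v /exact_atP [gf cf]; apply/exact_atP; split.
  by rewrite -(compA _ u') (compA u') u'u comp1m -compA gf compm0.
move=> T a vgua.
have gua : g ∘ (u' ∘ a) = 0.
  by rewrite -[LHS]comp1m -v'v -compA !(compA v) [v ∘ g ∘ _]compA vgua compm0.
have [t tc] : exists t, t ∘ coker_mor f = coker_mor (u ∘ f) ∘ u.
  by apply: coker_desc_ex; rewrite -compA (coker_morP _).1.
by rewrite -[a]comp1m -uu' -compA compA -tc -compA cf ?compm0.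
Qed.

(** A sequence of complexes that induces zero on [H0] is exact on [H0] if it is
    split epi on the right in degree [-1], split exact in the middle in degree
    [0], and split mono on the left in degree [1]. *)
Lemma H0_exact (K L N : complex A) (f : complex_mor K L) (g : complex_mor L N)
    (r : mor (L 0) (K 0)) (s : mor (N 0) (L 0))
    (r1 : mor (L 1) (K 1)) (s1 : mor (N (- 1)) (L (- 1))) :
  H0_map g ∘ H0_map f = 0 -> g (- 1) ∘ s1 = idm _ ->
  f 0 ∘ r + s ∘ g 0 = idm _ -> r1 ∘ f 1 = idm _ ->
  exact_at (H0_map f) (H0_map g).
Proof.
move=> gf gs frsg rf; apply/exact_atP; split=> // T a ga.
have [T1 [q1 [x [eq1 xa]]]] := hclass_cover a.
have /hclass0_cover [T2 [q2 [c [eq2 gxc]]]] : hclass (g 0 ∘ x) 0.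
  by have := H0_map_class g xa; rewrite compA ga comp0m.
have cg : g 0 ∘ d_in L = d_in N ∘ g (- 1) := cmorP g (- 1).
have cf : f 1 ∘ d_out K = d_out L ∘ f 0 := cmorP f 0.
(* correct the cycle [x] by a boundary, so that [g] kills it *)
pose y := x ∘ q2 - d_in L ∘ (s1 ∘ c).
have gy : g 0 ∘ y = 0.
  rewrite compDr compmN [g 0 ∘ (d_in L ∘ _)]compA cg -compA [g (- 1) ∘ _]compA gs.
  by rewrite comp1m compA gxc subrr.
have fry : f 0 ∘ (r ∘ y) = y.
  by rewrite -[RHS]comp1m -frsg compDl -!compA gy compm0 addr0.
have dy : d_out L ∘ y = 0.
  rewrite compDr compmN !compA (hclass_cycle xa) d_out_in.
  by rewrite !comp0m subrr.
have dry : d_out K ∘ (r ∘ y) = 0.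
  by rewrite -[LHS]comp1m -rf -compA [f 1 ∘ _]compA cf -compA fry dy compm0.
have [b rb] := hclass_ex dry.
have e : a ∘ q1 ∘ q2 = H0_map f ∘ b.
  apply: (hclass_bound (c := s1 ∘ c)) (hclass_comp q2 xa) (H0_map_class f rb) _.
  by rewrite fry subrK.
apply: eq1; apply: eq2; rewrite comp0m comp0m -!compA [a ∘ _]compA e compA.
by rewrite (coker_morP _).1 comp0m.
Qed.

End Abelian.

(** * Weight data on a cone *)

Section Cones.
Context {C : triangulated} {w : weight_structure C} {X Y Z : C}.
Context {f : mor X Y} {g : mor Y Z} {h : mor Z (shift X)}.
Context (dfgh : dist f g h) (DX : wdata w X) (DY : wdata w Y).

(** A choice of [w_{<=i} Z -> Z] whose source is the cone of a map
    [w_{<=i-1} X -> w_{<=i} Y], compatibly with the triangle on [X], [Y], [Z]. *)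
Record cone_trunc (i : int) := ConeTrunc {
  ct_obj : C;
  ct_f : mor (wleM DX (i - 1)) (wleM DY i);
  ct_a : mor (wleM DY i) ct_obj;
  ct_b : mor ct_obj (shift (wleM DX (i - 1)));
  ct_h : mor ct_obj Z;
  ct_wh : wh DY i ∘ ct_f = f ∘ wh DX (i - 1);
  ct_dist : dist ct_f ct_a ct_b;
  ct_ha : ct_h ∘ ct_a = g ∘ wh DY i;
  ct_hb : h ∘ ct_h = fmap shift (wh DX (i - 1)) ∘ ct_b;
  ct_trunc : wtrunc w i ct_h }.

(** A map between consecutive truncations of [Z], with its cone [cs_gr] in the
    role of [Z_i] and maps [Y_i -> Z_i -> X_{i-1}[1]]. *)
Record cone_step (i : int) (k' : cone_trunc (i - 1)) (k : cone_trunc i) :=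
    ConeStep {
  cs_j : mor (ct_obj k') (ct_obj k);
  cs_gr : C;
  cs_in : mor (ct_obj k) cs_gr;
  cs_out : mor cs_gr (shift (ct_obj k'));
  cs_m : mor (gr DY i) cs_gr;
  cs_n : mor cs_gr (shift (gr DX (i - 1)));
  cs_hj : ct_h k ∘ cs_j = ct_h k';
  cs_dist : dist cs_j cs_in cs_out;
  cs_m_in : cs_m ∘ gr_in DY i = cs_in ∘ ct_a k;
  cs_m_out : cs_out ∘ cs_m = fmap shift (ct_a k') ∘ gr_out DY i;
  cs_n_in : cs_n ∘ cs_in = fmap shift (gr_in DX (i - 1)) ∘ ct_b k;
  cs_n_out : (- fmap shift (gr_out DX (i - 1))) ∘ cs_n
             = fmap shift (ct_b k') ∘ cs_out }.

(** The maps [Y_i -> Z_i -> X_{i-1}[1]] exhibit [Z_i] as a direct sum. *)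
Definition cone_step_splits i (k' : cone_trunc (i - 1)) (k : cone_trunc i)
    (s : cone_step k' k) : Prop :=
  exists (r : mor (cs_gr s) (gr DY i)) (t : mor (shift (gr DX (i - 1))) (cs_gr s)),
    [/\ r ∘ cs_m s = idm _, cs_n s ∘ t = idm _
      & cs_m s ∘ r + t ∘ cs_n s = idm _].

Lemma ct_f_ex i : exists l : mor (wleM DX (i - 1)) (wleM DY i),
  wh DY i ∘ l = f ∘ wh DX (i - 1).
Proof.
apply: wtrunc_lift (wtrunc_wh DY i) _.
by have := wle_succ (wleM_le DX (i - 1)); rewrite subrK.
Qed.

Lemma ct_wle i (l : mor (wleM DX (i - 1)) (wleM DY i)) K a b :
  @dist C _ _ K l a b -> wle w i K.
Proof.
move=> d; apply: wle_ext ((dist_rot _ _ _).1 d) (wleM_le DY i) _.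
by have := shifted_shift (wleM_le DX (i - 1)); rewrite subrK.
Qed.

Lemma cone_trunc_ex i : inhabited (cone_trunc i).
Proof.
have [l hl] := ct_f_ex i; have [K [a [b dl]]] := dist_cone l.
have [k [G [gi [go [m [n [e [dk dmn [ka kb] _ _]]]]]]]] :=
  dist3x3 (wh_dist DX (i - 1)) (wh_dist DY i) dl dfgh (esym hl).
apply: inhabits; apply: (@ConeTrunc i K l a b k hl dl ka kb).
split; first exact: ct_wle dl.
exists G, gi, go; split=> //; apply: wge_ext dmn _ _; first exact: wgeM_ge.
by have := shifted_shift (wgeM_ge DX (i - 1 + 1)); rewrite subrK.
Qed.

Lemma cone_step_ex i (k' : cone_trunc (i - 1)) (k : cone_trunc i) :
  inhabited (cone_step k' k).
Proof.
have [j kj] := wtrunc_lift (ct_h k') (ct_trunc k)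
  (eq_ind _ (fun p => wle w p _) (wle_succ (ct_trunc k').1) _ (subrK 1 i)).
have ja : ct_a k ∘ wj DY i = j ∘ ct_a k'.
  apply: wtrunc_inj (ct_trunc k) (wleM_le DY (i - 1)) _.
  by rewrite !compA kj !ct_ha -compA wh_wj.
have jb : fmap shift (wj DX (i - 1)) ∘ ct_b k' = ct_b k ∘ j.
  have t := wtrunc_shift (wtrunc_wh DX (i - 1)); rewrite subrK in t.
  apply: wtrunc_inj t (ct_trunc k').1 _.
  by rewrite !compA -fmapM wh_wj -!ct_hb -compA kj.
have [G [gi [go dj]]] := dist_cone j.
have [m [mi mo]] := dist_mor (gr_dist DY i) dj ja.
have [n [ni no]] := dist_mor dj (dist_shift (gr_dist DX (i - 1))) (esym jb).
exact: inhabits (ConeStep kj dj mi (esym mo) ni (esym no)).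
Qed.

(** Given [w_{<=i} Z], the object [w_{<=i-1} Z] can be chosen so that [Z_i] is
    the direct sum of [Y_i] and [X_{i-1}[1]]: the extension given by the 3x3
    lemma is classified by a map [X_{i-1} -> Y_i], which vanishes. *)
Lemma cone_step_split_ex i (k : cone_trunc i) :
  exists (k' : cone_trunc (i - 1)) (s : cone_step k' k), cone_step_splits s.
Proof.
have [l hl] := ct_f_ex (i - 1); have [K [a [b dl]]] := dist_cone l.
have fj : ct_f k ∘ wj DX (i - 1) = wj DY i ∘ l.
  apply: wtrunc_inj (wtrunc_wh DY i) _ _.
    have := wle_succ (wleM_le DX (i - 1 - 1)); rewrite subrK; exact.
  by rewrite !compA ct_wh wh_wj hl -compA wh_wj.
have [j [G [gi [go [m [n [e [dj dmn [ja jb] [mi mo] [ni no]]]]]]]]] :=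
  dist3x3 (gr_dist DX (i - 1)) (gr_dist DY i) dl (ct_dist k) fj.
have wK := ct_wle dl.
have wG : wge w i G.
  apply: wge_ext dmn (gr_ge DY i) _.
  by have := shifted_shift (gr_ge DX (i - 1)); rewrite subrK.
have ka : ct_h k ∘ j ∘ a = g ∘ wh DY (i - 1).
  by rewrite -compA ja compA ct_ha -compA wh_wj.
have kb : h ∘ (ct_h k ∘ j) = fmap shift (wh DX (i - 1 - 1)) ∘ b.
  by rewrite compA ct_hb -compA jb compA -fmapM wh_wj.
pose k' := ConeTrunc hl dl ka kb (wtrunc_comp wK dj wG (ct_trunc k)).
exists k', (@ConeStep i k' k j G gi go m n erefl dj mi mo ni no).
have e0 : e = 0.
  by apply: w_orthz (gr_le DX (i - 1)) _; rewrite subrK; apply: gr_ge.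
by rewrite e0 fmap0 oppr0 in dmn; apply: dist_split dmn.
Qed.

Lemma cone_tower_ex :
  exists (k : forall i, cone_trunc i) (s : forall i, cone_step (k (i - 1)) (k i)),
    [/\ cone_step_splits (s 1), cone_step_splits (s 0)
      & cone_step_splits (s (- 1))].
Proof.
pose kd i := inhabited_witness (cone_trunc_ex i).
have [k0 [s1 sp1]] := cone_step_split_ex (kd 1).
have [k1 [s0 sp0]] := @cone_step_split_ex 0 k0.
have [k2 [sN1 spN1]] := @cone_step_split_ex (- 1) k1.
(* the chain [kd 1], [k0], [k1], [k2] has split steps; elsewhere any choice does *)
pose k (i : int) : cone_trunc i :=
  match i with
  | Posz 0 => k0 | Negz 0 => k1 | Negz 1 => k2 | j => kd j
  end.
pose sd i := inhabited_witness (cone_step_ex (k (i - 1)) (k i)).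
pose s (i : int) : cone_step (k (i - 1)) (k i) :=
  match i return cone_step (k (i - 1)) (k i) with
  | Posz 1 => s1 | Posz 0 => s0 | Negz 0 => sN1 | j => sd j
  end.
by exists k, s.
Qed.

Lemma shift_trunc i : wtrunc w i (fmap shift (wh DX (i - 1))).
Proof. by have := wtrunc_shift (wtrunc_wh DX (i - 1)); rewrite subrK. Qed.

Lemma shift_wj i :
  fmap shift (wh DX (i - 1)) ∘ fmap shift (wj DX (i - 1))
  = fmap shift (wh DX (i - 1 - 1)).
Proof. by rewrite -fmapM wh_wj. Qed.

(** The shifted data of [X[1]], with [wleM shift_wdata i = w_{<=i-1} X [1]]. *)
Definition shift_wdata : wdata w (shift X) :=
  wdata_of shift_trunc shift_wj (fun i => dist_shift (gr_dist DX (i - 1))).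

(** Exactness for suitable data of [Z]. That the composite vanishes is left as
    a premise, as it follows at once from functoriality. *)
Lemma HF_exact (A : abelian) (F : additive_functor (heart w) A) :
  exists (DZ : wdata w Z) (phi : wdata_mor DY DZ g)
    (psi : wdata_mor DZ shift_wdata h),
    HF_mor F psi ∘ HF_mor F phi = 0 -> exact_at (HF_mor F phi) (HF_mor F psi).
Proof.
have [k [s [sp1 sp0 spN1]]] := cone_tower_ex.
pose DZ := wdata_of (fun i => ct_trunc (k i)) (fun i => cs_hj (s i))
  (fun i => cs_dist (s i)).
have [phi phiE] : exists phi : wdata_mor DY DZ g, forall i, mgr phi i = cs_m (s i).
  apply: (@wdata_mor_of _ _ _ _ DY DZ g (fun i => ct_a (k i))
    (fun i => cs_m (s i))) => i.
  - exact: ct_ha.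
  - exact: esym (cs_m_in (s i)).
  - exact: cs_m_out.
have [psi psiE] : exists psi : wdata_mor DZ shift_wdata h,
    forall i, mgr psi i = cs_n (s i).
  apply: (@wdata_mor_of _ _ _ _ DZ shift_wdata h (fun i => ct_b (k i))
    (fun i => cs_n (s i))) => i.
  - exact: esym (ct_hb (k i)).
  - exact: esym (cs_n_in (s i)).
  - exact: cs_n_out.
exists DZ, phi, psi => gf.
have [_ [t1 [_ nt1 _]]] := sp1.
have [r0 [t0 [_ _ mn0]]] := sp0.
have [rN1 [_ [rmN1 _ _]]] := spN1.
refine (@H0_exact A _ _ _ (map_complex_mor F (weight_complex_mor phi))
  (map_complex_mor F (weight_complex_mor psi))
  (fmap F (r0 : mor (wobj DZ 0) (wobj DY 0)))
  (fmap F (t0 : mor (wobj shift_wdata 0) (wobj DZ 0)))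
  (fmap F (fmap (shz 1) rN1 : mor (wobj DZ 1) (wobj DY 1)))
  (fmap F (fmap (shz (- 1)) t1
             : mor (wobj shift_wdata (- 1)) (wobj DZ (- 1)))) gf _ _ _).
- rewrite /= -fmapM -[RHS]fmap1 /wmor psiE; congr (fmap F _).
  have e : fmap (shz (- 1)) (cs_n (s 1)) ∘ fmap (shz (- 1)) t1 = idm _.
    by rewrite -fmapM nt1 fmap1.
  exact: e.
- rewrite /= -!fmapM -fmapD -[RHS]fmap1 /wmor phiE psiE; congr (fmap F _).
  exact: mn0.
- rewrite /= -fmapM -[RHS]fmap1 /wmor phiE; congr (fmap F _).
  have e : fmap (shz 1) rN1 ∘ fmap (shz 1) (cs_m (s (- 1))) = idm _.
    by rewrite -fmapM rmN1 fmap1.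
  exact: e.
Qed.

End Cones.

(** * The functor [H] *)

Section HFunctor.
Context {C : triangulated} {w : weight_structure C} {A : abelian}.
Context (F : additive_functor (heart w) A).

Lemma HF_mor_null (M M' : C) (D : wdata w M) (D' : wdata w M') (g : mor M M')
    (phi : wdata_mor D D' g) : g = 0 -> HF_mor F phi = 0.
Proof.
move=> g0; move: phi; rewrite g0 => phi; have [s [t e]] := mgr_null phi.
apply: (@H0_map_null A _ _ (map_complex_mor F (weight_complex_mor phi))
  (fmap F s) (fmap F t)).
by rewrite /= e fmapD !fmapM.
Qed.

Lemma HF_mor_uniq (M M' : C) (D : wdata w M) (D' : wdata w M') (g : mor M M')
    (phi psi : wdata_mor D D' g) : HF_mor F phi = HF_mor F psi.
Proof.
have [npsi npsiE] := wdata_mor_opp psi.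
have [chi chiE] := wdata_mor_add phi npsi.
rewrite -[RHS]addr0 -(HF_mor_null chi (subrr g)); apply: H0_mapD.
rewrite /= -fmapD /wmor chiE npsiE; congr (fmap F _).
by rewrite -[RHS]fmapD addrC subrK.
Qed.

(** [H(g)], for any extension of [g] to the given data. *)
Definition HF_fun (M M' : C) (D : wdata w M) (D' : wdata w M') (g : mor M M') :
    mor (HF F D) (HF F D') :=
  HF_mor F (inhabited_witness (wdata_mor_ex D D' g)).

Lemma HF_funE (M M' : C) (D : wdata w M) (D' : wdata w M') (g : mor M M')
    (phi : wdata_mor D D' g) : HF_fun D D' g = HF_mor F phi.
Proof. exact: HF_mor_uniq. Qed.

Lemma HF_fun1 (M : C) (D : wdata w M) : HF_fun D D (idm M) = idm (HF F D).
Proof.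
have [phi phiE] := wdata_mor_id (D := D); rewrite (HF_funE phi).
apply: H0_map_id; rewrite /= -[RHS]fmap1; congr (fmap F _).
by rewrite /wmor phiE fmap1.
Qed.

Lemma HF_funM (M M' M'' : C) (D : wdata w M) (D' : wdata w M') (D'' : wdata w M'')
    (g : mor M' M'') (f : mor M M') :
  HF_fun D D'' (g ∘ f) = HF_fun D' D'' g ∘ HF_fun D D' f.
Proof.
have [phi] := wdata_mor_ex D D' f; have [psi] := wdata_mor_ex D' D'' g.
have [chi chiE] := wdata_mor_comp psi phi.
rewrite (HF_funE phi) (HF_funE psi) (HF_funE chi).
apply: H0_map_comp; rewrite /= -fmapM; congr (fmap F _).
by rewrite /wmor chiE; apply: fmapM.
Qed.

Lemma HF_funD (M M' : C) (D : wdata w M) (D' : wdata w M') (f g : mor M M') :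
  HF_fun D D' (f + g) = HF_fun D D' f + HF_fun D D' g.
Proof.
have [phi] := wdata_mor_ex D D' f; have [psi] := wdata_mor_ex D D' g.
have [chi chiE] := wdata_mor_add phi psi.
rewrite (HF_funE phi) (HF_funE psi) (HF_funE chi).
apply: H0_mapD; rewrite /= -fmapD; congr (fmap F _).
by rewrite /wmor chiE; apply: fmapD.
Qed.

Lemma HF_fun0 (M M' : C) (D : wdata w M) (D' : wdata w M') :
  HF_fun D D' 0 = 0.
Proof. exact: HF_mor_null erefl. Qed.

(** The triangle is rotated back to [Z[-1] -> X -> Y -> Z[-1][1]], and the data
    of [Y] and of [Z[-1][1]] are replaced by those of [HF_exact]. *)
Lemma HF_fun_exact (X Y Z : C) (f : mor X Y) (g : mor Y Z) (h : mor Z (shift X))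
    (DX : wdata w X) (DY : wdata w Y) (DZ : wdata w Z)
    (DW : wdata w (unshift Z)) :
  dist f g h -> exact_at (HF_fun DX DY f) (HF_fun DY DZ g).
Proof.
move=> d.
have [b [ba ab]] := @unshiftK_iso C Z.
(* [a] generalizes [unshiftK Z], typed without the composite functors *)
have [a aE] : exists a : mor (shift (unshift Z)) Z, a = unshiftK Z by exists (unshiftK Z).
rewrite /= -aE in b ba ab.
have [k kh] := shift_full (- (h ∘ a)).
have dk : dist k f (b ∘ g).
  apply/dist_rot; rewrite kh opprK.
  apply: (dist_iso (u := idm _) (v := idm _) (w := b)) d.
  - exact: is_iso_id.
  - exact: is_iso_id.
  - by exists a.
  - by rewrite comp1m compm1.
  - by rewrite compm1.
  - by rewrite fmap1 comp1m -compA ab compm1.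
have [DY' [phi [psi]]] := HF_exact dk DW DX F.
rewrite -!HF_funE -HF_funM -compA (dist_comp0 d) compm0 HF_fun0 => /(_ erefl) ex.
have -> : HF_fun DX DY f = HF_fun DY' DY (idm Y) ∘ HF_fun DX DY' f.
  by rewrite -HF_funM comp1m.
have -> : HF_fun DY DZ g = HF_fun (shift_wdata DW) DZ a
    ∘ HF_fun DY' (shift_wdata DW) (b ∘ g) ∘ HF_fun DY DY' (idm Y).
  by rewrite -!HF_funM compm1 compA ab comp1m.
apply: (exact_at_iso (v' := HF_fun DZ (shift_wdata DW) b)) ex.
- by rewrite -HF_funM comp1m HF_fun1.
- by rewrite -HF_funM comp1m HF_fun1.
- by rewrite -HF_funM ba HF_fun1.
Qed.

End HFunctor.
Theorem proposition2p3p1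
    (C : triangulated) (w : weight_structure C) (A : abelian) :
  exists H : forall (F : additive_functor (heart w) A) (M M' : C)
               (D : wdata w M) (D' : wdata w M'),
               mor M M' -> mor (HF F D) (HF F D'),
  [/\ (* H is defined on morphisms by extending them to the chosen data *)
      forall (F : additive_functor (heart w) A) (M M' : C)
        (D : wdata w M) (D' : wdata w M') (g : mor M M'),
        inhabited (wdata_mor D D' g) /\
        (forall phi : wdata_mor D D' g, H F M M' D D' g = HF_mor F phi),
      (* each choice t of weight complexes yields a homological functor *)
      forall (F : additive_functor (heart w) A) (t : forall M : C, wdata w M),
        @homological C A (fun M => HF F (t M))
          (fun M M' => H F M M' (t M) (t M')),
      (* two choices yield canonically isomorphic functors *)
      forall (F : additive_functor (heart w) A) (t t' : forall M : C, wdata w M),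
        (forall M : C, is_iso (H F M M (t M) (t' M) (idm M))) /\
        (forall (M M' : C) (g : mor M M'),
           H F M' M' (t M') (t' M') (idm M') ∘ H F M M' (t M) (t M') g
           = H F M M' (t' M) (t' M') g ∘ H F M M (t M) (t' M) (idm M))
      (* natural transformations F -> F' induce, functorially, natural
         transformations between the corresponding functors *)
    & [/\ forall (F F' : additive_functor (heart w) A) (a : nattrans F F')
            (M M' : C) (D : wdata w M) (D' : wdata w M') (g : mor M M'),
            HF_nat a D' ∘ H F M M' D D' g = H F' M M' D D' g ∘ HF_nat a D,
          forall (F : additive_functor (heart w) A) (M : C) (D : wdata w M),
            HF_nat (nat_id F) D = idm (HF F D)
        & forall (F F' F'' : additive_functor (heart w) A)
            (b : nattrans F' F'') (a : nattrans F F') (M : C) (D : wdata w M),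
            HF_nat (nat_comp b a) D = HF_nat b D ∘ HF_nat a D]].
Proof.
exists (fun F M M' D D' g => HF_fun F D D' g); split.
- by move=> F M M' D D' g; split=> [|phi]; [apply: wdata_mor_ex | apply: HF_funE].
- move=> F t; split=> [|X Y Z f g h]; last first.
    exact: HF_fun_exact (t (unshift Z)).
  by split=> *; [apply: HF_fun1 | apply: HF_funM | apply: HF_funD].
- move=> F t t'; split=> [M | M M' g]; last by rewrite -!HF_funM comp1m compm1.
  by exists (HF_fun F (t' M) (t M) (idm M)); rewrite -!HF_funM comp1m !HF_fun1.
- split=> [F F' a M M' D D' g | F M D | F F' F'' b a M D].
  + have [phi] := wdata_mor_ex D D' g; rewrite !(HF_funE _ phi).
    by apply: H0_map_square; rewrite /= nnat.
  + exact: H0_map_id.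
  + exact: H0_map_comp.
Qed.
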